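(* Let $(M_1\times_fM_2,F)$ be a twisted product Finsler manifold. Then the coefficients of the Berwald curvature are as follows: $$\begin{aligned}\mathbf B^\gamma_{\alpha\beta\lambda}=B^\gamma_{\alpha\beta\lambda}+f^{-1}\big(&C^{\gamma\nu}_{\lambda;\alpha;\beta}f_\nu F_2^2+2C^{\gamma\nu}_{\alpha;\beta}f_\nu v_\lambda+2C^{\gamma\nu}_{\alpha;\lambda}f_\nu v_\beta+2C^{\gamma\nu}_\alpha f_\nu g_{\lambda\beta}\\&+2C^{\gamma\nu}_{\lambda;\beta}f_\nu v_\alpha+2C^{\gamma\nu}_\beta f_\nu g_{\lambda\alpha}+2C^{\gamma\nu}_\lambda f_\nu g_{\alpha\beta}-2C_{\alpha\beta\lambda}f^\gamma\big),\end{aligned}$$ $$\mathbf B^k_{ijl}=B^k_{ijl}+fC^{kh}_{l;j;i}f_hF_2^2,\qquad \mathbf B^k_{i\beta l}=2fC^{kh}_{i;l}f_hv_\beta,\qquad \mathbf B^k_{\alpha\beta l}=2fg_{\alpha\beta}C^{kh}_lf_h,$$ $$\mathbf B^k_{\alpha\beta\lambda}=-2fC_{\alpha\beta\lambda}f^k,\qquad \mathbf B^\gamma_{i\beta\lambda}=\mathbf B^\gamma_{ij\lambda}=\mathbf B^\gamma_{ijk}=0 .$$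
   Context: Let $(M_1,F_1)$, $(M_2,F_2)$ be Finsler manifolds (metrics smooth on the slit tangent bundle, positively 1-homogeneous on fibres, with positive definite fundamental tensor) and $f:M_1\times M_2\to\mathbb{R}^+$ smooth. The twisted product $M_1\times_f M_2$ is $M=M_1\times M_2$ with $F=\sqrt{F_1^2(x,y)+f^2(x,u)F_2^2(u,v)}$, considered where $y\ne0$, $v\ne 0$. Local coordinates are $\mathbf{x}^a=(x^i,u^\alpha)$ with fibre coordinates $\mathbf{y}^a=(y^i,v^\alpha)$; Latin indices refer to $M_1$, Greek to $M_2$. With $\mathbf g_{ab}=\frac12\frac{\partial^2F^2}{\partial\mathbf y^a\partial\mathbf y^b}$ and $\mathbf G^a=\frac14\mathbf g^{ab}\big(\frac{\partial^2F^2}{\partial\mathbf y^b\partial\mathbf x^c}\mathbf y^c-\frac{\partial F^2}{\partial\mathbf x^b}\big)$, the Berwald curvature of $F$ is $\mathbf B^d_{abc}=\frac{\partial^3\mathbf G^d}{\partial\mathbf y^a\partial\mathbf y^b\partial\mathbf y^c}$. $B^k_{ijl}$ and $B^\gamma_{\alpha\beta\lambda}$ are the Berwald curvatures of $F_1$ and $F_2$, defined by the same formulas. $g_{ij}=\frac12(F_1^2)_{y^iy^j}$, $g_{\alpha\beta}=\frac12(F_2^2)_{v^\alpha v^\beta}$, $v_\alpha=g_{\alpha\beta}v^\beta$, $C_{ijk}=\frac12\frac{\partial g_{ij}}{\partial y^k}$, $C_{\alpha\beta\gamma}=\frac12\frac{\partial g_{\alpha\beta}}{\partial v^\gamma}$,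 $C^{kh}_l=g^{ki}g^{hj}C_{ijl}$, $C^{\gamma\nu}_\alpha=g^{\gamma\mu}g^{\nu\kappa}C_{\mu\kappa\alpha}$; a subscript $;j$ denotes $\partial/\partial y^j$ and $;\beta$ denotes $\partial/\partial v^\beta$. $f_h=\frac{\partial f}{\partial x^h}$, $f_\nu=\frac{\partial f}{\partial u^\nu}$, $f^k=g^{kh}f_h$, $f^\gamma=g^{\gamma\nu}f_\nu$. *)

(* Defs.v *)
From HB Require Import structures.
From mathcomp Require Import all_boot all_order all_algebra.
From mathcomp Require Import all_classical all_reals all_analysis.

Set Implicit Arguments.
Unset Strict Implicit.
Unset Printing Implicit Defensive.

Import Order.TTheory GRing.Theory Num.Theory.
Import numFieldNormedType.Exports.

Local Open Scope classical_set_scope.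
Local Open Scope ring_scope.

Definition iter_derive (R : realType) (V W : normedModType R)
    (s : seq V) (f : V -> W) : V -> W :=
  foldr (fun v g => 'D_v g) f s.

(* For finite-dimensional V and open U this is the usual C^oo: iterated
   derivatives along arbitrary vectors are linear combinations of iterated
   partial derivatives. *)
Definition smooth_on (R : realType) (V W : normedModType R)
    (U : set V) (f : V -> W) : Prop :=
  forall (s : seq V) (x : V), U x ->
    {for x, continuous (iter_derive s f)} /\
    (forall v : V, derivable (iter_derive s f) x v).

(* cmap c and cinv c are only meaningful on cdom c and cimg c respectively. *)
Record atlas (R : realType) (n : nat) := Atlas {
  carrier :> topologicalType;
  chart : Type;
  cdom : chart -> set carrier;
  cmap : chart -> carrier -> 'rV[R]_n;
  cinv : chart -> 'rV[R]_n -> carrier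
}.
Arguments chart {R n} a.
Arguments cdom {R n a} c.
Arguments cmap {R n a} c.
Arguments cinv {R n a} c.

Definition cimg (R : realType) (n : nat) (M : atlas R n) (c : chart M) :
  set 'rV[R]_n := cmap c @` cdom c.

Record is_smooth_manifold (R : realType) (n : nat) (M : atlas R n) : Prop := {
  mfd_hausdorff : hausdorff_space M;
  mfd_second_countable : second_countable (T := M);
  mfd_cover : forall p : M, exists c : chart M, cdom c p;
  mfd_open_dom : forall c : chart M, open (cdom c);
  mfd_open_img : forall c : chart M, open (cimg c);
  mfd_cmapK : forall (c : chart M) (p : M), cdom c p -> cinv c (cmap c p) = p;
  mfd_cmap_cont : forall c : chart M, {within cdom c, continuous (cmap c)};
  mfd_cinv_cont : forall c : chart M, {within cimg c, continuous (cinv c)};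
  mfd_transition : forall c c' : chart M,
    smooth_on (cmap c @` (cdom c `&` cdom c')) (cmap c' \o cinv c)
}.

Definition prod_atlas (R : realType) (n1 n2 : nat)
    (M1 : atlas R n1) (M2 : atlas R n2) : atlas R (n1 + n2) :=
  @Atlas R (n1 + n2) (M1 * M2)%type (chart M1 * chart M2)%type
    (fun c => cdom c.1 `*` cdom c.2)
    (fun c p => row_mx (cmap c.1 p.1) (cmap c.2 p.2))
    (fun c X => (cinv c.1 (lsubmx X), cinv c.2 (rsubmx X))).

Definition smooth_fun (R : realType) (n : nat) (M : atlas R n) (f : M -> R) :
    Prop :=
  forall c : chart M, smooth_on (cimg c) (f \o cinv c : _ -> R^o).

Section LocalFormulas.
Context {R : realType} {n : nat}.

Definition basis_vec (a : 'I_n) : 'rV[R]_n := delta_mx 0 a.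

Definition partial (a : 'I_n) (h : 'rV[R]_n -> R) : 'rV[R]_n -> R :=
  'D_(basis_vec a) (h : _ -> R^o).

(* L x y : a function of base coordinates x and fibre coordinates y *)
Definition dx (a : 'I_n) (L : 'rV[R]_n -> 'rV[R]_n -> R)
    (x y : 'rV[R]_n) : R :=
  partial a (fun x' => L x' y) x.

Definition dy (a : 'I_n) (L : 'rV[R]_n -> 'rV[R]_n -> R)
    (x y : 'rV[R]_n) : R :=
  partial a (L x) y.

Variable F : 'rV[R]_n -> 'rV[R]_n -> R.

Definition sqF (x y : 'rV[R]_n) : R := F x y ^+ 2.

Definition fund (a b : 'I_n) (x y : 'rV[R]_n) : R :=
  2^-1 * dy a (dy b sqF) x y.

Definition fund_mx (x y : 'rV[R]_n) : 'M[R]_n :=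
  \matrix_(a, b) fund a b x y.

Definition fund_inv (a b : 'I_n) (x y : 'rV[R]_n) : R :=
  invmx (fund_mx x y) a b.

Definition spray (a : 'I_n) (x y : 'rV[R]_n) : R :=
  4^-1 * \sum_b (fund_inv a b x y *
    ((\sum_c dy b (dx c sqF) x y * y 0 c) - dx b sqF x y)).

(* B^d_{abc} *)
Definition berwald (d a b c : 'I_n) (x y : 'rV[R]_n) : R :=
  dy a (dy b (dy c (spray d))) x y.

(* C_{abc} *)
Definition cartan (a b c : 'I_n) (x y : 'rV[R]_n) : R :=
  2^-1 * dy c (fund a b) x y.

(* C^{ab}_c *)
Definition cartan_up (a b c : 'I_n) (x y : 'rV[R]_n) : R :=
  \sum_i \sum_j fund_inv a i x y * fund_inv b j x y * cartan i j c x y.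

(* v_a = g_{ab} v^b *)
Definition fib_low (a : 'I_n) (x y : 'rV[R]_n) : R :=
  \sum_b fund a b x y * y 0 b.

End LocalFormulas.

(* A function on the tangent bundle, given by its expressions F c x y in the
   induced coordinates; is_finsler requires them to agree on overlaps. *)
Definition tangent_fun (R : realType) (n : nat) (M : atlas R n) :=
  chart M -> 'rV[R]_n -> 'rV[R]_n -> R.

Record is_finsler (R : realType) (n : nat) (M : atlas R n)
    (F : tangent_fun M) : Prop := {
  fins_tensorial : forall (c c' : chart M) (x y : 'rV[R]_n),
    (cmap c @` (cdom c `&` cdom c')) x ->
    F c' (cmap c' (cinv c x)) ('D_y (cmap c' \o cinv c) x) = F c x y;
  fins_ge0 : forall (c : chart M) (x y : 'rV[R]_n),
    cimg c x -> 0 <= F c x y;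
  fins_smooth : forall c : chart M,
    smooth_on (cimg c `*` [set y | y != 0])
      ((fun p => F c p.1 p.2) : 'rV[R]_n * 'rV[R]_n -> R^o);
  fins_homog : forall (c : chart M) (x y : 'rV[R]_n) (t : R),
    cimg c x -> 0 < t -> F c x (t *: y) = t * F c x y;
  fins_posdef : forall (c : chart M) (x y w : 'rV[R]_n),
    cimg c x -> y != 0 -> w != 0 ->
    0 < \sum_a \sum_b fund (F c) a b x y * w 0 a * w 0 b
}.

Definition twisted (R : realType) (n1 n2 : nat)
    (M1 : atlas R n1) (M2 : atlas R n2)
    (F1 : tangent_fun M1) (F2 : tangent_fun M2) (f : M1 * M2 -> R) :
    tangent_fun (prod_atlas M1 M2) :=
  fun c X Y =>
    Num.sqrt (F1 c.1 (lsubmx X) (lsubmx Y) ^+ 2 +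
              f (cinv c.1 (lsubmx X), cinv c.2 (rsubmx X)) ^+ 2 *
              F2 c.2 (rsubmx X) (rsubmx Y) ^+ 2).

(* Main.v *)
Require Import Defs.
From mathcomp Require Import all_boot all_order all_algebra.
From mathcomp Require Import all_classical all_reals all_analysis.
From mathcomp Require Import ring lra.

Set Implicit Arguments.
Unset Strict Implicit.
Unset Printing Implicit Defensive.

Import Order.TTheory GRing.Theory Num.Theory.
Import numFieldNormedType.Exports.
Local Open Scope classical_set_scope.
Local Open Scope ring_scope.

(** The square of the twisted metric is [F1^2 + f^2 F2^2], so its fundamental
    tensor is block diagonal with blocks [g1] and [f^2 g2], and the sprays are
      [G^k = G1^k - (1/2) f F2^2 g1^{kh} f_h],
      [G^gamma = G2^gamma + f^-1 (f_i y^i + f_al v^al) v^gamma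
                 - (1/2) f^-1 F2^2 g2^{gamma nu} f_nu],
    where Euler's identity [(F2^2)_{;be} = 2 v_be] has been used.  Each of them
    is a sum of two products of a function of [y] by a function of [v].  The
    third fibre derivatives follow from Leibniz' rule,
    [g^{kh}_{;l} = - 2 C^{kh}_l], and the symmetry of iterated derivatives. *)

(** * Calculus along directions *)

(** Smoothness is stated through iterated directional derivatives, so additivity of ['D_v f] in [v]
    and the symmetry of mixed derivatives are theorems here; both are drawn from the one-variable
    mean value theorem and continuity. Most other transfers rest on one remark: a directional
    derivative sees only values on a line, so a function may be exchanged with its slice or its
    block even when the two live on different spaces. The shape [a(y) b(v) + c(y) d(v)] of the
    sprays matters because every fibre derivative reproduces it: a Latin index acts on [a] and [c],
    a Greek one on [b] and [d]. The zero coefficients come from the term [f^-1 (f_i y^i) v^gamma],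
    the only part of [G^gamma] that involves [y]: it is bilinear, hence lost after three
    derivatives. The index orders in the statement can be met because, contracted with the
    differential of [f], the tensors [C^{kh}_{l;j}] are second derivatives of [f^k] up to a
    factor. *)

Section Smooth.
Context {R : realType} {V : normedModType R}.
Implicit Types (U : set V) (f g : V -> R^o) (v w x : V).

Lemma derive_eq_on U f g v x : open U -> U x ->
  (forall z, U z -> f z = g z) -> 'D_v f x = 'D_v g x.
Proof.
move=> oU Ux fg; apply: near_eq_derive.
by apply: filterS (open_nbhs_nbhs (conj oU Ux)) => z /fg.
Qed.

Lemma derivable_eq_on U f g v x : open U -> U x ->
  (forall z, U z -> f z = g z) -> derivable f x v -> derivable g x v.
Proof.
(* Equality near [x] passes to difference quotients along a genuine direction; the direction [0] is
   treated apart. *)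
move=> oU Ux fg; have [->|v0] := eqVneq v 0; first by move=> _; exact: derivable0.
apply: near_eq_derivable => //.
by apply: filterS (open_nbhs_nbhs (conj oU Ux)) => z /fg.
Qed.

(* Functions obtained algebraically from smooth ones.  This class is stable under
   differentiation, which makes its members smooth without writing down the
   iterated derivatives of a product or of a quotient. *)
Inductive smooth_alg U : (V -> R^o) -> Prop :=
| SmoothBase f : smooth_on U f -> smooth_alg U f
| SmoothAdd f g : smooth_alg U f -> smooth_alg U g ->
    smooth_alg U (fun x => f x + g x)
| SmoothMul f g : smooth_alg U f -> smooth_alg U g ->
    smooth_alg U (fun x => f x * g x)
| SmoothInv f : smooth_alg U f -> (forall x, U x -> f x != 0) ->
    smooth_alg U (fun x => (f x)^-1)
| SmoothExt f g : smooth_alg U f -> (forall x, U x -> f x = g x) ->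
    smooth_alg U g.

(** [foldr] applies the last direction first, so [x] differentiates the constant and the other
    directions only differentiate [0]. *)
Lemma iter_derive_cst s (k : R) (x : V) :
  iter_derive (rcons s x) (fun=> k : R^o) = (fun _ : V => 0 : R^o).
Proof.
elim: s => [|v s IH] /=; last rewrite IH.
  by apply/funext => z; exact: (derive_cst (k : R^o)).
by apply/funext => z; exact: (derive_cst (0 : R^o)).
Qed.

Lemma smooth_cst U (k : R) : smooth_on U (fun=> k : R^o).
Proof.
move=> s x _.
have [c ->] : exists c : R, iter_derive s (fun=> k : R^o) = fun=> c : R^o.
  case/lastP: s => [|s v]; first by exists k.
  by exists 0; rewrite iter_derive_cst.
by split=> [|v]; [exact: cvg_cst|exact: derivable_cst].
Qed.

Lemma smooth_derive U f v : smooth_on U f -> smooth_on U ('D_v f).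
Proof.
move=> sf s x Ux; have := sf (rcons s v) x Ux.
by rewrite /iter_derive foldr_rcons.
Qed.

Lemma smooth_derivable U f v x : smooth_on U f -> U x -> derivable f x v.
Proof. by move=> sf Ux; case: (sf [::] x Ux) => _; exact. Qed.

Lemma smooth_continuous U f x : smooth_on U f -> U x -> {for x, continuous f}.
Proof. by move=> sf Ux; case: (sf [::] x Ux). Qed.

(** Induction on the construction. The sum, product and quotient rules give the derivative at points
    of [U] only, and [SmoothExt] absorbs this restriction. *)
Lemma smooth_alg_derive U f : open U -> smooth_alg U f ->
  [/\ forall x, U x -> {for x, continuous f},
      forall x v, U x -> derivable f x v &
      forall v, smooth_alg U ('D_v f)].
Proof.
move=> oU; elim=> {f}.
- move=> f sf; split.
  + by move=> x; exact: smooth_continuous.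
  + by move=> x v; exact: smooth_derivable.
  + by move=> v; apply/SmoothBase/smooth_derive.
- move=> f g af [cf df Df] ag [cg dg Dg]; split.
  + by move=> x Ux; apply: cvgD; [exact: cf|exact: cg].
  + by move=> x v Ux; apply: derivableD; [exact: df|exact: dg].
  + move=> v; apply: SmoothExt (SmoothAdd (Df v) (Dg v)) _ => x Ux.
    by rewrite -deriveD//; [exact: df|exact: dg].
- move=> f g af [cf df Df] ag [cg dg Dg]; split.
  + by move=> x Ux; apply: cvgM; [exact: cf|exact: cg].
  + by move=> x v Ux; apply: derivableM; [exact: df|exact: dg].
  + move=> v; apply: SmoothExt (SmoothAdd (SmoothMul af (Dg v))
      (SmoothMul ag (Df v))) _ => x Ux.
    by have := deriveM (df x v Ux) (dg x v Ux) => ->.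
- move=> f af [cf df Df] f0; split.
  + by move=> x Ux; apply: cvgV; [exact: f0|exact: cf].
  + by move=> x v Ux; apply: derivableV; [exact: f0|exact: df].
  (* The derivative [- f^-2 * 'D_v f] written with the constructors, the sign being a constant
     function. *)
  + move=> v; apply: SmoothExt (SmoothMul (SmoothMul
      (SmoothBase (smooth_cst (U := U) (-1))) (SmoothInv (SmoothMul af af) _)) (Df v)) _.
      by move=> x Ux; rewrite mulf_neq0// f0.
    by move=> x Ux; rewrite deriveV ?f0//; [rewrite mulN1r|exact: df].
- move=> f g af [cf df Df] fg; split.
  + move=> x Ux; rewrite /prop_for /continuous_at -(fg x Ux).
    have nx := open_nbhs_nbhs (conj oU Ux).
    apply: cvg_trans (cf x Ux); apply: near_eq_cvg.
    by apply: filterS nx => z /fg.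
  + by move=> x v Ux; exact: (derivable_eq_on oU Ux fg (df x v Ux)).
  + move=> v; apply: SmoothExt (Df v) _ => x Ux.
    exact: (derive_eq_on v oU Ux fg).
Qed.

Lemma smooth_algP U f : open U -> smooth_alg U f -> smooth_on U f.
Proof.
move=> oU af s x Ux.
have {af} : smooth_alg U (iter_derive s f).
  by elim: s => [//|v s IH] /=; have [_ _] := smooth_alg_derive oU IH.
by move=> /(smooth_alg_derive oU) [cf df _]; split; [exact: cf|move=> v; exact: df].
Qed.

Lemma smoothD U f g : open U -> smooth_on U f -> smooth_on U g ->
  smooth_on U (fun x => f x + g x : R^o).
Proof.
by move=> oU /SmoothBase sf /SmoothBase sg; apply/smooth_algP/SmoothAdd.
Qed.

Lemma smoothM U f g : open U -> smooth_on U f -> smooth_on U g ->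
  smooth_on U (fun x => f x * g x : R^o).
Proof.
by move=> oU /SmoothBase sf /SmoothBase sg; apply/smooth_algP/SmoothMul.
Qed.

Lemma smoothV U f : open U -> smooth_on U f -> (forall x, U x -> f x != 0) ->
  smooth_on U (fun x => (f x)^-1 : R^o).
Proof. by move=> oU /SmoothBase sf f0; apply/smooth_algP/SmoothInv. Qed.

Lemma smooth_ext U f g : open U -> smooth_on U f ->
  (forall x, U x -> f x = g x) -> smooth_on U g.
Proof. by move=> oU /SmoothBase sf fg; apply/smooth_algP/(SmoothExt sf). Qed.

Lemma smoothB U f g : open U -> smooth_on U f -> smooth_on U g ->
  smooth_on U (fun x => f x - g x : R^o).
Proof.
move=> oU sf sg.
apply: smooth_ext (smoothD oU sf (smoothM oU (smooth_cst (-1)) sg)) _ => //.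
by move=> x _; rewrite mulN1r.
Qed.

Lemma smooth_sum (I : Type) (r : seq I) U (f : I -> V -> R^o) : open U ->
  (forall i, smooth_on U (f i)) ->
  smooth_on U (fun x => \sum_(i <- r) f i x : R^o).
Proof.
move=> oU sf; elim: r => [|i r IH].
  by apply: smooth_ext (smooth_cst 0) _ => // x _; rewrite big_nil.
apply: smooth_ext (smoothD oU (sf i) IH) _ => // x _.
by rewrite big_cons.
Qed.

Lemma smooth_prod (I : Type) (r : seq I) U (f : I -> V -> R^o) : open U ->
  (forall i, smooth_on U (f i)) ->
  smooth_on U (fun x => \prod_(i <- r) f i x : R^o).
Proof.
move=> oU sf; elim: r => [|i r IH].
  by apply: smooth_ext (smooth_cst 1) _ => // x _; rewrite big_nil.
apply: smooth_ext (smoothM oU (sf i) IH) _ => // x _.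
by rewrite big_cons.
Qed.

Lemma smooth_det U n (A : V -> 'M[R]_n) : open U ->
  (forall i j, smooth_on U (fun x => A x i j : R^o)) ->
  smooth_on U (fun x => \det (A x) : R^o).
Proof.
move=> oU sA; rewrite /determinant; apply: smooth_sum => // s.
by apply: smoothM => //; [exact: smooth_cst|apply: smooth_prod].
Qed.

(** Cramer's rule: each entry is a cofactor, polynomial in the entries of [A], divided by the
    determinant. *)
Lemma smooth_invmx U n (A : V -> 'M[R]_n) : open U ->
  (forall i j, smooth_on U (fun x => A x i j : R^o)) ->
  (forall x, U x -> A x \in unitmx) ->
  forall i j, smooth_on U (fun x => invmx (A x) i j : R^o).
Proof.
move=> oU sA uA i j.
have sC : smooth_on U (fun x => (\det (A x))^-1 * \adj (A x) i j : R^o).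
  apply: smoothM => //.
    apply: smoothV => // [|x Ux]; first exact: smooth_det.
    by rewrite -unitfE -unitmxE uA.
  have -> : (fun x => \adj (A x) i j) = (fun x => cofactor (A x) j i).
    by apply/funext => x; rewrite mxE.
  rewrite /cofactor; apply: smoothM => //; first exact: smooth_cst.
  apply: smooth_det => // k l.
  have -> : (fun x => row' j (col' i (A x)) k l) =
            (fun x => A x (lift j k) (lift i l)) :> (V -> R^o).
    by apply/funext => x; rewrite !mxE.
  exact: sA.
by apply: smooth_ext sC _ => // x Ux; rewrite /invmx uA// !mxE.
Qed.

Lemma derive_sum_fun (I : Type) (r : seq I) (f : I -> V -> R^o) v x :
  (forall i, derivable (f i) x v) ->
  'D_v (fun z => \sum_(i <- r) f i z : R^o) x = \sum_(i <- r) 'D_v (f i) x.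
Proof.
move=> df.
(* Derivability of the partial sums is carried along, since the sum rule asks for it on the tail. *)
suff [_ //] : derivable (fun z => \sum_(i <- r) f i z : R^o) x v /\
  'D_v (fun z => \sum_(i <- r) f i z : R^o) x = \sum_(i <- r) 'D_v (f i) x.
elim: r => [|i r [IH1 IH2]].
  rewrite big_nil; under eq_fun do rewrite big_nil.
  by split; [exact: derivable_cst|exact: (derive_cst (0 : R^o))].
rewrite big_cons; under eq_fun do rewrite big_cons.
split; first exact: derivableD.
by have -> := deriveD (df i) IH1; rewrite IH2.
Qed.

End Smooth.

(** A difference quotient reads only the values on the line through the point, so the two quotients
    are the same function of [h]. This takes the place of a chain rule for slices, blocks and
    translations. *)
Lemma derive_eq_line (R : realType) (V V' : normedModType R) (f : V -> R^o)
    (g : V' -> R^o) (v x : V) (v' x' : V') :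
  (forall h : R, f (h *: v + x) = g (h *: v' + x')) ->
  'D_v f x = 'D_v' g x'.
Proof.
move=> fg; have f0 : f x = g x' by have := fg 0; rewrite !scale0r !add0r.
have E : (fun h : R => h^-1 *: ((f \o shift x) (h *: v) - f x)) =
    (fun h : R => h^-1 *: ((g \o shift x') (h *: v') - g x')).
  by apply/funext => h /=; rewrite fg f0.
by rewrite /derive E.
Qed.

Lemma derivable_eq_line (R : realType) (V V' : normedModType R) (f : V -> R^o)
    (g : V' -> R^o) (v x : V) (v' x' : V') :
  (forall h : R, f (h *: v + x) = g (h *: v' + x')) ->
  derivable g x' v' -> derivable f x v.
Proof.
move=> fg; have f0 : f x = g x' by have := fg 0; rewrite !scale0r !add0r.
have E : (fun h : R => h^-1 *: ((f \o shift x) (h *: v) - f x)) =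
    (fun h : R => h^-1 *: ((g \o shift x') (h *: v') - g x')).
  by apply/funext => h /=; rewrite fg f0.
by rewrite /derivable E.
Qed.

(** * Linearity in the direction and symmetry of derivatives, from the mean value theorem *)

Section MeanValue.
Context {R : realType} {V : normedModType R}.
Implicit Types (U : set V) (f g : V -> R^o) (v w x : V).

Lemma is_derive_line f x v (s : R) : derivable f (x + s *: v) v ->
  is_derive s 1 (fun t : R => f (x + t *: v)) ('D_v f (x + s *: v)).
Proof.
have E (h : R) : f (x + (h *: (1 : R) + s) *: v) = f (h *: v + (x + s *: v)).
  by rewrite -[h *: (1 : R)]/(h * 1) mulr1 scalerDl addrCA.
move=> df; apply: DeriveDef; last first.
  exact: (derive_eq_line (f := fun t : R => f (x + t *: v) : R^o) E).
exact: (derivable_eq_line (f := fun t : R => f (x + t *: v) : R^o) E df).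
Qed.

Lemma mean_value_along f x v (t : R) : 0 < t ->
  (forall s, 0 <= s <= t -> derivable f (x + s *: v) v) ->
  exists2 c, 0 <= c <= t & f (x + t *: v) - f x = t * 'D_v f (x + c *: v).
Proof.
move=> t0 df.
have := @MVT R (fun s => f (x + s *: v)) (fun s => 'D_v f (x + s *: v)) 0 t t0.
case.
- move=> s; rewrite in_itv/= => /andP[s0 st]; apply: is_derive_line.
  by apply: df; rewrite !ltW.
- apply: derivable_within_continuous => s; rewrite in_itv/= => st.
  by have [] := is_derive_line (df s st).
- move=> c; rewrite in_itv/= => /andP[c0 ct].
  rewrite scale0r addr0 subr0 => E.
  by exists c; [rewrite !ltW|rewrite E mulrC].
Qed.

Lemma small_parallelogram U x v w (e : R) : open U -> U x -> 0 < e ->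
  exists2 t, 0 < t & forall a b, 0 <= a <= t -> 0 <= b <= t ->
    U (x + a *: v + b *: w) /\ ball x e (x + a *: v + b *: w).
Proof.
move=> oU Ux e0.
have /nbhs_ballP[d /= d0 dU] := open_nbhs_nbhs (conj oU Ux).
pose m := Num.min e d.
have m0 : 0 < m by rewrite lt_min e0.
(* The summand [1] keeps the scale positive when [v = w = 0] and makes the final bound strict. *)
pose k := 1 + `|v| + `|w|.
have k0 : 0 < k by rewrite /k -addrA ltr_wpDr// addr_ge0.
exists (m / k) => [|a b /andP[a0 am] /andP[b0 bm]]; first exact: divr_gt0.
suff H : `|x - (x + a *: v + b *: w)| < m.
  split; last by rewrite -ball_normE/=; apply: lt_le_trans H _; rewrite ge_min lexx.
  by apply: dU; rewrite -ball_normE/=; apply: lt_le_trans H _; rewrite ge_min lexx orbT.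
rewrite -addrA opprD addrA subrr add0r normrN.
apply: le_lt_trans (ler_normD _ _) _; rewrite !normrZ !ger0_norm//.
apply: (@le_lt_trans _ _ (m / k * (`|v| + `|w|))).
  by rewrite mulrDr lerD// ler_wpM2r.
rewrite mulrAC ltr_pdivrMr// ltr_pM2l// /k; lra.
Qed.

(** Mean values give an identity at three possibly different points near [x]; continuity carries it
    to [x], at a cost of [e / 3] for each function. *)
Lemma continuous_pointwise_add f g (h : V -> R^o) x :
  {for x, continuous f} -> {for x, continuous g} -> {for x, continuous h} ->
  (forall e : R, 0 < e -> exists p q r,
     [/\ ball x e p, ball x e q, ball x e r & f p = g q + h r]) ->
  f x = g x + h x.
Proof.
move=> cf cg ch H; apply/eqP; rewrite -subr_eq0 -normr_le0.
apply/ler_addgt0Pr => e e0; rewrite add0r.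
have e3 : 0 < e / 3 by rewrite divr_gt0.
have near_x (k : V -> R^o) : {for x, continuous k} ->
    exists2 d : R, 0 < d & forall z, ball x d z -> `|k x - k z| < e / 3.
  move=> /cvgr_dist_lt/(_ _ e3)/nbhs_ballP[d /= d0 dk].
  by exists d.
have [d1 d10 k1] := near_x f cf.
have [d2 d20 k2] := near_x g cg.
have [d3 d30 k3] := near_x h ch.
have m0 : 0 < Num.min d1 (Num.min d2 d3) by rewrite !lt_min d10 d20.
have [p [q [r [bp bq br E]]]] := H _ m0.
have {k1}k1 : `|f x - f p| < e / 3.
  by apply: k1; apply: le_ball bp; rewrite !ge_min lexx.
have {k2}k2 : `|g x - g q| < e / 3.
  by apply: k2; apply: le_ball bq; rewrite !ge_min lexx orbT.
have {k3}k3 : `|h x - h r| < e / 3.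
  by apply: k3; apply: le_ball br; rewrite !ge_min lexx !orbT.
have -> : f x - (g x + h x) = (f x - f p) - (g x - g q) - (h x - h r).
  by rewrite E; ring.
apply: le_trans (ler_normB _ _) _.
apply: le_trans (lerD (ler_normB _ _) (lexx _)) _.
apply: le_trans (lerD (lerD (ltW k1) (ltW k2)) (ltW k3)) _; lra.
Qed.

(** The diagonal from [x] to [x + t (v + w)] has the same endpoints as the two legs through
    [x + t w]. The mean value theorem on the diagonal and on each leg gives the identity at three
    nearby points, after division by [t]. *)
Lemma deriveDl U f v w x : open U -> smooth_on U f -> U x ->
  'D_(v + w) f x = 'D_v f x + 'D_w f x.
Proof.
move=> oU sf Ux.
have cD z : {for x, continuous ('D_z f)}.
  exact: smooth_continuous (smooth_derive z sf) Ux.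
apply: (@continuous_pointwise_add ('D_(v + w) f) ('D_v f) ('D_w f)) => // e e0.
have [t t0 H] := small_parallelogram v w oU Ux e0.
have H1 c : 0 <= c <= t -> U (x + c *: (v + w)) /\ ball x e (x + c *: (v + w)).
  by move=> ct; rewrite scalerDr addrA; exact: H.
have H2 c : 0 <= c <= t ->
    U (x + t *: w + c *: v) /\ ball x e (x + t *: w + c *: v).
  by move=> ct; rewrite addrAC; apply: H => //; rewrite lexx ltW.
have H3 c : 0 <= c <= t -> U (x + c *: w) /\ ball x e (x + c *: w).
  move=> ct; have := H 0 c; rewrite scale0r addr0; apply => //.
  by rewrite lexx ltW.
have [c1 c1t E1] : exists2 c, 0 <= c <= t &
    f (x + t *: (v + w)) - f x = t * 'D_(v + w) f (x + c *: (v + w)).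
  apply: mean_value_along => // s /H1[Us _]; exact: smooth_derivable sf Us.
have [c2 c2t E2] : exists2 c, 0 <= c <= t &
    f (x + t *: w + t *: v) - f (x + t *: w) =
    t * 'D_v f (x + t *: w + c *: v).
  apply: mean_value_along => // s /H2[Us _]; exact: smooth_derivable sf Us.
have [c3 c3t E3] : exists2 c, 0 <= c <= t &
    f (x + t *: w) - f x = t * 'D_w f (x + c *: w).
  apply: mean_value_along => // s /H3[Us _]; exact: smooth_derivable sf Us.
exists (x + c1 *: (v + w)), (x + t *: w + c2 *: v), (x + c3 *: w).
split; [exact: (H1 _ _).2|exact: (H2 _ _).2|exact: (H3 _ _).2|].
apply: (mulfI (lt0r_neq0 t0)); rewrite mulrDr -E1 -E2 -E3.
have -> : x + t *: (v + w) = x + t *: w + t *: v by rewrite scalerDr addrA addrAC.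
ring.
Qed.

(** The second difference is an increment along [v] of [z |-> f (z + t w) - f z]. A first mean value
    turns it into an increment of ['D_v f] along [w], to which a second one applies. *)
Lemma second_difference U f v w x (t : R) : smooth_on U f -> 0 < t ->
  (forall a b, 0 <= a <= t -> 0 <= b <= t -> U (x + a *: v + b *: w)) ->
  exists a b, [/\ 0 <= a <= t, 0 <= b <= t &
    f (x + t *: v + t *: w) - f (x + t *: v) - f (x + t *: w) + f x =
    t * (t * 'D_w ('D_v f) (x + a *: v + b *: w))].
Proof.
move=> sf t0 H.
have H0 a : 0 <= a <= t -> U (x + a *: v).
  move=> at_; have := H a 0 at_; rewrite scale0r addr0; apply.
  by rewrite lexx ltW.
have dg a : 0 <= a <= t ->
    derivable (fun z => f (z + t *: w)) (x + a *: v) v /\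
    derivable f (x + a *: v) v.
  move=> at_; split; last exact: smooth_derivable sf (H0 _ at_).
  apply: (@derivable_eq_line _ _ _ _ f _ _ v (x + a *: v + t *: w)).
    by move=> h; rewrite -[h *: v + _ + _]addrA.
  by apply: smooth_derivable sf _; apply: H => //; rewrite lexx ltW.
have [a at_ E] : exists2 a, 0 <= a <= t &
    (f (x + t *: v + t *: w) - f (x + t *: v)) - (f (x + t *: w) - f x) =
    t * 'D_v (fun z => f (z + t *: w) - f z : R^o) (x + a *: v).
  apply: (@mean_value_along (fun z => f (z + t *: w) - f z : R^o)) => // s st.
  by have [d1 d2] := dg s st; exact: (derivableB d1 d2).
have [b bt E'] : exists2 b, 0 <= b <= t &
    'D_v f (x + a *: v + t *: w) - 'D_v f (x + a *: v) =
    t * 'D_w ('D_v f) (x + a *: v + b *: w).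
  apply: (@mean_value_along ('D_v f)) => // s st.
  by apply: smooth_derivable (smooth_derive v sf) _; exact: H.
exists a, b; split => //; rewrite -E'.
have [d1 d2] := dg a at_.
have <- : 'D_v (fun z => f (z + t *: w) - f z : R^o) (x + a *: v) =
    'D_v f (x + a *: v + t *: w) - 'D_v f (x + a *: v).
  apply: etrans (deriveB d1 d2) _; congr (_ - _).
  by apply: derive_eq_line => h; rewrite -[h *: v + _ + _]addrA.
by rewrite -E opprB addrA addrAC.
Qed.

(** The second difference over a parallelogram is symmetric in [v] and [w], so the two mixed
    derivatives take a common value at points as close to [x] as desired. *)
Lemma derive_comm U f v w x : open U -> smooth_on U f -> U x ->
  'D_w ('D_v f) x = 'D_v ('D_w f) x.
Proof.
move=> oU sf Ux.
have cD y z : {for x, continuous ('D_y ('D_z f))}.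
  exact: smooth_continuous (smooth_derive y (smooth_derive z sf)) Ux.
(* The comparison lemma has two summands on its right-hand side; the second is taken to be [0]. *)
rewrite -[RHS]addr0.
apply: (@continuous_pointwise_add ('D_w ('D_v f)) ('D_v ('D_w f))
  (fun=> 0)) => // [|e e0].
  exact: cvg_cst.
have [t t0 H] := small_parallelogram v w oU Ux e0.
have [a [b [at_ bt E]]] := second_difference sf t0
  (fun a b at_ bt => (H a b at_ bt).1).
have H' c d : 0 <= c <= t -> 0 <= d <= t ->
    U (x + c *: w + d *: v) /\ ball x e (x + c *: w + d *: v).
  by move=> ct dt; rewrite addrAC; exact: H.
have [c [d [ct dt E']]] := second_difference sf t0
  (fun c d ct dt => (H' c d ct dt).1).
exists (x + a *: v + b *: w), (x + c *: w + d *: v), x.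
split; [exact: (H _ _ _ _).2|exact: (H' _ _ _ _).2|exact: ballxx|].
rewrite addr0; apply: (mulfI (lt0r_neq0 t0)); apply: (mulfI (lt0r_neq0 t0)).
apply: etrans (esym E) _; apply: etrans E'.
by rewrite [x + t *: w + t *: v]addrAC; congr (_ + _); exact: addrAC.
Qed.

(** On the line through [x] along [v], scaling the direction is the one-variable reparametrization
    [t |-> k t]. *)
Lemma deriveZl U f v x (k : R) : smooth_on U f -> U x ->
  'D_(k *: v) f x = k * 'D_v f x.
Proof.
move=> sf Ux; pose p (t : R) := f (x + t *: v).
have d1 : is_derive (0 : R) 1 p ('D_v f x).
  have := @is_derive_line f x v 0; rewrite scale0r addr0; apply.
  exact: smooth_derivable sf Ux.
have -> : 'D_(k *: v) f x = 'D_1 (p \o ( *%R k)) 0.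
  apply: derive_eq_line => h; rewrite /p /= addr0 -[h *: (1 : R)]/(h * 1) mulr1.
  by rewrite scalerA mulrC addrC.
have [dp <-] := d1.
rewrite -!derive1E derive1_comp ?mulr0//.
- by rewrite mulrC; congr (_ * _); rewrite derive1Ml// derive1_id mulr1.
Qed.

Lemma derive_sum_dir U f (I : Type) (r : seq I) (w : I -> V) x :
  open U -> smooth_on U f -> U x ->
  'D_(\sum_(i <- r) w i) f x = \sum_(i <- r) 'D_(w i) f x.
Proof.
move=> oU sf Ux; elim: r => [|i r IH]; first by rewrite !big_nil derive0.
by rewrite !big_cons (deriveDl _ _ oU sf Ux) IH.
Qed.

(* No derivability is needed: both sides are [0] when the limit does not exist. *)
Lemma derive_mulr f v x (k : R) :
  'D_v (fun z => f z * k : R^o) x = 'D_v f x * k.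
Proof.
have dM g (c : R) : derivable g x v -> derivable (fun z => g z * c : R^o) x v.
  by move=> dg; apply: (derivableM dg); exact: derivable_cst.
have [df|ndf] := pselect (derivable f x v).
  have -> := deriveM df (derivable_cst (k : R^o) x v).
  by rewrite (derive_cst (k : R^o)) scaler0 add0r /GRing.scale/= mulrC.
have [->|k0] := eqVneq k 0.
  under eq_fun do rewrite mulr0; rewrite mulr0.
  exact: (derive_cst (0 : R^o)).
have ndk : ~ derivable (fun z => f z * k : R^o) x v.
  move=> /dM dk; apply: ndf; have := dk (k^-1 : R).
  by under eq_fun do rewrite mulfK//.
have D0 g : ~ derivable g x v -> 'D_v g x = 0 by move=> /dvgP.
by rewrite (D0 _ ndk) (D0 _ ndf) mul0r.
Qed.

End MeanValue.

(** * Slices of a function on a product *)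

Section Fibre.
Context {R : realType} {V1 V2 : normedModType R}.

Lemma pair_line_snd (v y : V2) (x : V1) (h : R) :
  h *: ((0, v) : V1 * V2) + (x, y) = (x, h *: v + y).
Proof. by rewrite -[LHS]/(h *: 0 + x, h *: v + y) scaler0 add0r. Qed.

Lemma pair_line_fst (v x : V1) (y : V2) (h : R) :
  h *: ((v, 0) : V1 * V2) + (x, y) = (h *: v + x, y).
Proof. by rewrite -[LHS]/(h *: v + x, h *: 0 + y) scaler0 add0r. Qed.

(** Iterated derivatives of the slice along [v] are those of [H] along [(0, v)], so joint smoothness
    restricts to fibres at every order. *)
Lemma smooth_fibre (A : set V1) (B : set V2) (H : V1 * V2 -> R^o) (x : V1) :
  smooth_on (A `*` B) H -> A x -> smooth_on B (fun y => H (x, y)).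
Proof.
move=> sH Ax s y By.
have E : iter_derive s (fun y => H (x, y)) =
    (fun y => iter_derive [seq (0, v) | v <- s] H (x, y)).
  elim: s => [//|v s IH] /=; apply/funext => z; rewrite IH.
  apply: derive_eq_line => h; congr (iter_derive _ H _).
  by rewrite pair_line_snd.
rewrite E; have [cH dH] := sH [seq (0, v) | v <- s] (x, y) (conj Ax By); split.
  apply: (@continuous_comp _ _ _ (fun y => (x, y))) => //.
  by apply: cvg_pair => //=; exact: cvg_cst.
move=> v; apply: derivable_eq_line (dH (0, v)) => h.
by rewrite pair_line_snd.
Qed.

Lemma derive_pair_fst (H : V1 * V2 -> R^o) (v x : V1) (y : V2) :
  'D_v (fun z => H (z, y)) x = 'D_((v, 0) : V1 * V2) H (x, y).
Proof.
apply: derive_eq_line => h.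
by rewrite pair_line_fst.
Qed.

Lemma derivable_pair_fst (H : V1 * V2 -> R^o) (v x : V1) (y : V2) :
  derivable H (x, y) ((v, 0) : V1 * V2) -> derivable (fun z => H (z, y)) x v.
Proof.
apply: derivable_eq_line => h.
by rewrite pair_line_fst.
Qed.

End Fibre.

Lemma derive_mull {R : realType} {V : normedModType R} (f : V -> R^o) (v x : V)
  (k : R) : 'D_v (fun z => k * f z : R^o) x = k * 'D_v f x.
Proof. by under eq_fun do rewrite mulrC; rewrite derive_mulr mulrC. Qed.

(** * The slit fibre and its coordinate functions *)

Definition slit {R : realType} {n : nat} : set 'rV[R]_n := [set y | y != 0].

Lemma open_setX (T1 T2 : topologicalType) (A : set T1) (B : set T2) :
  open A -> open B -> open (A `*` B).
Proof.
move=> oA oB; rewrite openE => -[a b] [/= Aa Bb].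
exists (A, B) => //=; split.
  exact: open_nbhs_nbhs (conj oA Aa).
exact: open_nbhs_nbhs (conj oB Bb).
Qed.

Section Slit.
Context {R : realType} {n : nat}.
Local Notation S := (@slit R n).

Lemma open_slit : open S.
Proof.
have -> : S = ~` [set 0].
  by apply/seteqP; split => y /=; rewrite /slit/= => /eqP.
rewrite openC; apply: accessible_closed_set1; apply: hausdorff_accessible.
exact: norm_hausdorff.
Qed.

Lemma derive_coord (i : 'I_n) (v x : 'rV[R]_n) :
  'D_v (fun z : 'rV[R]_n => z 0 i : R^o) x = v 0 i.
Proof.
have -> : 'D_v (fun z : 'rV[R]_n => z 0 i : R^o) x =
    'D_(v 0 i) (@idfun R^o) (x 0 i).
  by apply: derive_eq_line => h; rewrite !mxE.
exact: (@derive_id _ R^o).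
Qed.

Lemma smooth_coord (U : set 'rV[R]_n) (i : 'I_n) :
  smooth_on U (fun z : 'rV[R]_n => z 0 i : R^o).
Proof.
move=> s x Ux; case/lastP: s => [|s v] /=.
  split; first exact: coord_continuous.
  move=> v; apply: (@derivable_eq_line _ _ _ _ (@idfun R^o) _ _ (v 0 i) (x 0 i)).
    by move=> h; rewrite !mxE.
  exact: derivable_id.
rewrite /iter_derive foldr_rcons.
have -> : 'D_v (fun z : 'rV[R]_n => z 0 i : R^o) = (fun=> v 0 i).
  by apply/funext => z; exact: derive_coord.
exact: smooth_cst Ux.
Qed.

Lemma derive_coords (U : set 'rV[R]_n) (f : 'rV[R]_n -> R^o) (v x : 'rV[R]_n) :
  open U -> smooth_on U f -> U x ->
  'D_v f x = \sum_i v 0 i * partial i f x.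
Proof.
move=> oU sf Ux; rewrite {1}[v]row_sum_delta (derive_sum_dir _ _ oU sf Ux).
by apply: eq_bigr => i _; rewrite (deriveZl _ _ sf Ux).
Qed.

Lemma smooth_partial (U : set 'rV[R]_n) (f : 'rV[R]_n -> R^o) (i : 'I_n) :
  smooth_on U f -> smooth_on U (partial i f : _ -> R^o).
Proof. exact: smooth_derive. Qed.

End Slit.

(** * A Finsler metric on one fibre *)

(** The Finsler structure as seen in one chart; the curvature formulas are chart expressions and are
    computed from this data. *)
Record local_finsler (R : realType) (n : nat)
    (F : 'rV[R]_n -> 'rV[R]_n -> R) (U : set 'rV[R]_n) : Prop := {
  lf_open : open U;
  lf_smooth : smooth_on (U `*` slit)
    ((fun p => F p.1 p.2) : 'rV[R]_n * 'rV[R]_n -> R^o);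
  lf_homog : forall (x y : 'rV[R]_n) (t : R), U x -> 0 < t ->
    F x (t *: y) = t * F x y;
  lf_posdef : forall x y w : 'rV[R]_n, U x -> y != 0 -> w != 0 ->
    0 < \sum_a \sum_b fund F a b x y * w 0 a * w 0 b
}.

Section FinslerFibre.
Context {R : realType} {n : nat} (F : 'rV[R]_n -> 'rV[R]_n -> R)
  (U : set 'rV[R]_n) (lF : local_finsler F U) (x : 'rV[R]_n) (Ux : U x).
Implicit Types (a b c k h l : 'I_n) (y : 'rV[R]_n).
Let oS : open (@slit R n) := open_slit.

Lemma smooth_sqF_pair : smooth_on (U `*` slit)
  ((fun p => sqF F p.1 p.2) : 'rV[R]_n * 'rV[R]_n -> R^o).
Proof.
apply: smoothM; [|exact: lf_smooth lF|exact: lf_smooth lF].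
by apply: open_setX => //; exact: lf_open lF.
Qed.

Lemma smooth_sqF : smooth_on slit (sqF F x : _ -> R^o).
Proof. exact: smooth_fibre smooth_sqF_pair Ux. Qed.

(** The base derivative is a derivative of the joint function along [(basis_vec c, 0)], smooth in
    both variables before it is restricted to the fibre over [x]. *)
Lemma smooth_dx_sqF c : smooth_on slit (dx c (sqF F) x : _ -> R^o).
Proof.
apply: (smooth_ext oS (smooth_fibre
  (smooth_derive (basis_vec c, 0) smooth_sqF_pair) Ux)) => y _; apply/esym.
exact: (@derive_pair_fst _ _ _ (fun p => sqF F p.1 p.2)).
Qed.

Lemma derivable_sqF_base c y : y != 0 ->
  derivable ((fun z => sqF F z y) : _ -> R^o) x (basis_vec c).
Proof.
move=> y0; apply: (@derivable_pair_fst _ _ _ (fun p => sqF F p.1 p.2)).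
exact: (@smooth_derivable _ _ _ _ (basis_vec c, 0) (x, y) smooth_sqF_pair
  (conj Ux y0)).
Qed.

Lemma smooth_fund a b : smooth_on slit (fund F a b x : _ -> R^o).
Proof.
apply: smoothM => //; first exact: smooth_cst.
by do 2 apply: smooth_partial; exact: smooth_sqF.
Qed.

(** A nonzero row vector killed by the matrix would have zero quadratic form, against positive
    definiteness. *)
Lemma fund_mx_unit y : y != 0 -> fund_mx F x y \in unitmx.
Proof.
move=> y0; rewrite unitmxE unitfE; apply/negP => /det0P[w w0 wG].
have := lf_posdef lF Ux y0 w0; apply/negP; rewrite -leNgt le_eqVlt; apply/orP; left.
have : (w *m fund_mx F x y *m w^T) 0 0 = 0 by rewrite wG mul0mx mxE.
rewrite mxE => /eqP; congr (_ == _); rewrite exchange_big/=.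
apply: eq_bigr => b _; rewrite !mxE mulr_suml; apply: eq_bigr => a _.
by rewrite !mxE [w 0 a * _]mulrC.
Qed.

Lemma smooth_fund_inv a b : smooth_on slit (fund_inv F a b x : _ -> R^o).
Proof.
apply: smooth_invmx => // [i j|y]; last exact: fund_mx_unit.
by apply: smooth_ext (smooth_fund i j) _ => // y _; rewrite mxE.
Qed.

Lemma smooth_spray a : smooth_on slit (spray F a x : _ -> R^o).
Proof.
apply: smoothM => //; first exact: smooth_cst.
apply: smooth_sum => // b; apply: smoothM => //; first exact: smooth_fund_inv.
apply: smoothB => //; last exact: smooth_dx_sqF.
apply: smooth_sum => // c; apply: smoothM => //; last exact: smooth_coord.
by apply: smooth_partial; exact: smooth_dx_sqF.
Qed.

Lemma smooth_cartan a b c : smooth_on slit (cartan F a b c x : _ -> R^o).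
Proof.
apply: smoothM => //; first exact: smooth_cst.
by apply: smooth_partial; exact: smooth_fund.
Qed.

Lemma smooth_cartan_up a b c : smooth_on slit (cartan_up F a b c x : _ -> R^o).
Proof.
do 2 (apply: smooth_sum => // ?).
apply: smoothM => //; last exact: smooth_cartan.
by apply: smoothM => //; exact: smooth_fund_inv.
Qed.

Lemma fund_sym a b y : y != 0 -> fund F a b x y = fund F b a x y.
Proof.
move=> y0; apply: (congr1 (fun t => 2^-1 * t)).
exact: (derive_comm _ _ oS smooth_sqF y0).
Qed.

Lemma dy_sqF_homog b y (t : R) : 0 < t -> y != 0 ->
  dy b (sqF F) x (t *: y) = t * dy b (sqF F) x y.
Proof.
(* A further factor [t] turns the left side into the derivative at [t y] along [t e_b], which a
   comparison of lines pulls back to [y]. *)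
move=> t0 y0; apply: (mulfI (lt0r_neq0 t0)).
have ty0 : slit (t *: y) by rewrite /slit/= scaler_eq0 negb_or y0 lt0r_neq0.
apply: (etrans (esym (deriveZl (basis_vec b) t smooth_sqF ty0))).
transitivity ('D_(basis_vec b) (fun z => t ^+ 2 * sqF F x z : R^o) y); last first.
  by rewrite derive_mull expr2 -mulrA.
apply/esym; apply: derive_eq_line => h; rewrite /sqF.
by rewrite scalerA [h * t]mulrC -scalerA -scalerDr (lf_homog lF _ Ux t0) exprMn.
Qed.

(** Both sides are the derivative of [dy b (sqF F)] along [y] itself: in coordinates it is
    [2 g_{bc} y^c], and along the ray [t y] the function is linear in [t] by homogeneity of degree
    one. *)
Lemma dy_sqF_fib_low b y : y != 0 -> dy b (sqF F) x y = 2 * fib_low F b x y.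
Proof.
move=> y0.
have sD : smooth_on slit (dy b (sqF F) x : _ -> R^o).
  by apply: smooth_partial; exact: smooth_sqF.
transitivity ('D_y (dy b (sqF F) x : _ -> R^o) y); last first.
  rewrite (derive_coords _ oS sD y0) /fib_low mulr_sumr; apply: eq_bigr => c _.
  by rewrite fund_sym// mulrA mulrA divff ?pnatr_eq0// mul1r mulrC.
(* The ray is the line through the origin at parameter [1]; homogeneity is available for [t > 0], an
   open neighbourhood of [1]. *)
have y1 : derivable (dy b (sqF F) x : _ -> R^o) (0 + 1 *: y) y.
  by rewrite add0r scale1r; exact: smooth_derivable sD y0.
have [_] := is_derive_line y1; rewrite add0r scale1r => <-; apply/esym.
rewrite (@derive_eq_on _ R^o [set t | 0 < t] _
  (fun t => t * dy b (sqF F) x y : R^o)) //=.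
- by rewrite (derive_mulr (@idfun R^o)) derive_id mul1r.
- by move=> t t0; rewrite add0r dy_sqF_homog.
Qed.

(** Differentiating [g^-1 g = 1] on the slit gives [d(g^-1) = - g^-1 (dg) g^-1]; the factor [2]
    undoes the one half in [cartan]. *)
Lemma dy_fund_inv k h l y : y != 0 ->
  dy l (fund_inv F k h) x y = - 2 * cartan_up F k h l x y.
Proof.
move=> y0; pose G := fund_mx F x y.
have uG : G \in unitmx by exact: fund_mx_unit.
pose dI := \matrix_(i, j) dy l (fund_inv F i j) x y.
pose dG := \matrix_(i, j) dy l (fund F i j) x y.
have GT : G^T = G.
  by apply/matrixP => i j; rewrite !mxE fund_sym.
have E : dI *m G + invmx G *m dG = 0.
  apply/matrixP => i j.
  have : partial l (fun z => (invmx (fund_mx F x z) *m fund_mx F x z) i j) y = 0.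
    rewrite /partial (@derive_eq_on _ _ slit _ (fun=> (1%:M : 'M[R]_n) i j)) //.
      exact: (derive_cst ((1%:M : 'M[R]_n) i j : R^o)).
    by move=> z z0; rewrite (mulVmx (fund_mx_unit z0)).
  have -> : (fun z => (invmx (fund_mx F x z) *m fund_mx F x z) i j) =
      (fun z => \sum_m fund_inv F i m x z * fund F m j x z).
    apply/funext => z; rewrite mxE; apply: eq_bigr => m _.
    by rewrite [fund_mx _ _ _ _ _]mxE.
  have dI' m : derivable (fund_inv F i m x : _ -> R^o) y (basis_vec l).
    exact: smooth_derivable (smooth_fund_inv i m) y0.
  have dG' m : derivable (fund F m j x : _ -> R^o) y (basis_vec l).
    exact: smooth_derivable (smooth_fund m j) y0.
  have D m : derivable (fun z => fund_inv F i m x z * fund F m j x z : R^o) y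
      (basis_vec l) by exact: (derivableM (dI' m) (dG' m)).
  rewrite /partial (derive_sum_fun _ D) => D0.
  rewrite [RHS]mxE -D0 !mxE -big_split/=; apply: eq_bigr => m _; rewrite !mxE.
  apply: etrans _ (esym (deriveM (dI' m) (dG' m))).
  by rewrite addrC; congr (_ + _); exact: mulrC.
have -> : dy l (fund_inv F k h) x y = dI k h by rewrite mxE.
have -> : dI = - (invmx G *m dG *m invmx G).
  have /eqP := E; rewrite addr_eq0 => /eqP E'.
  by rewrite -[LHS](mulmxK uG) E' mulNmx.
rewrite mxE mulNr; congr (- _); rewrite /cartan_up exchange_big/= mulr_sumr mxE.
apply: eq_bigr => j _; rewrite mxE mulr_suml mulr_sumr; apply: eq_bigr => i _.
(* In [cartan_up] the free index comes first in both inverse matrices, whereas the matrix product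
   puts it last in the second; the symmetry of [g] reconciles them. *)
have -> : invmx G j h = fund_inv F h j x y.
  by rewrite -[in LHS]GT -trmx_inv mxE.
rewrite /cartan [dG _ _]mxE -[invmx G k i]/(fund_inv F k i x y).
by field.
Qed.

(** The [4] undoes the halves in [fund] and [cartan]; two exchanges bring [c], differentiated last
    in [cartan], to the innermost place. *)
Lemma dy3_sqF a b c y : y != 0 ->
  dy a (dy b (dy c (sqF F))) x y = 4 * cartan F a b c x y.
Proof.
move=> y0; rewrite /cartan /fund.
rewrite [dy c _ _ _]derive_mull !mulrA.
have -> : 4 * 2^-1 * 2^-1 = 1 :> R by field.
rewrite mul1r.
transitivity (dy a (dy c (dy b (sqF F))) x y).
  apply: (derive_eq_on _ oS y0) => z z0.
  exact: (derive_comm _ _ oS smooth_sqF z0).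
exact: (derive_comm _ _ oS (smooth_partial _ smooth_sqF) y0).
Qed.

(** * Fibre derivatives of a covector raised by the fundamental tensor *)

Section RaisedCovector.
Variables (d : 'I_n -> R) (k : 'I_n).
(** This is [f^k] when [d] is the differential of [f] at the base point, which is constant along the
    fibre. *)
Let P y : R^o := \sum_h fund_inv F k h x y * d h.

Lemma smooth_raised : smooth_on slit P.
Proof.
apply: smooth_sum => // h; apply: smoothM => //; last exact: smooth_cst.
exact: smooth_fund_inv.
Qed.

Lemma partial_sum_mulr (C : 'I_n -> 'rV[R]_n -> R^o) (l : 'I_n) y :
  (forall h, smooth_on slit (C h)) -> y != 0 ->
  partial l (fun z => - 2 * \sum_h C h z * d h) y =
  - 2 * \sum_h partial l (C h) y * d h.
Proof.
move=> sC y0; apply: etrans (derive_mull _ _ _ _) _.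
apply: (congr1 (fun t => - 2 * t)).
apply: etrans (derive_sum_fun _ _) _ => [h|].
  have sCd : smooth_on slit (fun z => C h z * d h : R^o).
    by apply: smoothM => //; exact: smooth_cst.
  exact: smooth_derivable sCd y0.
by apply: eq_bigr => h _; exact: derive_mulr.
Qed.

Lemma partial_raised l y : y != 0 ->
  partial l P y = - 2 * \sum_h cartan_up F k h l x y * d h.
Proof.
move=> y0; apply: etrans (derive_sum_fun _ _) _ => [h|].
  have sCd : smooth_on slit (fun z => fund_inv F k h x z * d h : R^o).
    by apply: smoothM => //; [exact: smooth_fund_inv|exact: smooth_cst].
  exact: smooth_derivable sCd y0.
rewrite mulr_sumr; apply: eq_bigr => h _; apply: etrans (derive_mulr _ _ _ _) _.
by rewrite mulrA; apply: (congr1 (fun t => t * d h)); exact: dy_fund_inv.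
Qed.

Lemma partial2_raised j l y : y != 0 ->
  partial j (partial l P) y = - 2 * \sum_h dy j (cartan_up F k h l) x y * d h.
Proof.
move=> y0; apply: etrans (derive_eq_on _ oS y0 (partial_raised l)) _.
by apply: partial_sum_mulr => // h; exact: smooth_cartan_up.
Qed.

Lemma partial3_raised i j l y : y != 0 ->
  partial i (partial j (partial l P)) y =
  - 2 * \sum_h dy i (dy j (cartan_up F k h l)) x y * d h.
Proof.
move=> y0; apply: etrans (derive_eq_on _ oS y0 (partial2_raised j l)) _.
apply: partial_sum_mulr => // h; apply: smooth_partial.
exact: smooth_cartan_up.
Qed.

(** Up to the factor [- 2], both sums are second derivatives of [P], taken in the two orders. *)
Lemma cartan_up_sum_sym j l y : y != 0 ->
  \sum_h dy j (cartan_up F k h l) x y * d h =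
  \sum_h dy l (cartan_up F k h j) x y * d h.
Proof.
move=> y0; have N2 : - 2 != 0 :> R by rewrite oppr_eq0 pnatr_eq0.
apply: (mulfI N2); apply: (etrans (esym (partial2_raised j l y0))).
apply: etrans (partial2_raised l j y0).
exact: (derive_comm _ _ oS smooth_raised y0).
Qed.

Lemma dy2_cartan_up_sum_sym i j l y : y != 0 ->
  \sum_h dy i (dy j (cartan_up F k h l)) x y * d h =
  \sum_h dy j (dy i (cartan_up F k h l)) x y * d h.
Proof.
move=> y0; apply: eq_bigr => h _; apply: (congr1 (fun t => t * d h)).
exact: (derive_comm _ _ oS (smooth_cartan_up k h l) y0).
Qed.

End RaisedCovector.

(** Here [g^-1 g = 1] acts on the fibre vector; it turns the terms of the spray that carry [v_a]
    into multiples of [v^a]. *)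
Lemma fund_inv_fib_low a y : y != 0 ->
  \sum_b fund_inv F a b x y * fib_low F b x y = y 0 a.
Proof.
move=> y0; have := mulVmx (fund_mx_unit y0) => /(congr1 (mulmx^~ y^T)).
rewrite mul1mx -mulmxA => /matrixP/(_ a 0); rewrite [RHS]mxE => <-.
rewrite mxE; apply: eq_bigr => b _; apply: (congr1 (fun t => _ * t)).
by rewrite mxE; apply: eq_bigr => c _; rewrite !mxE.
Qed.

End FinslerFibre.

Lemma derive_addr {R : realType} {V : normedModType R} (f : V -> R^o) (v x : V)
  (k : R) : 'D_v (fun z => f z + k : R^o) x = 'D_v f x.
Proof.
have E : (fun h : R => h^-1 *: (((fun z => f z + k : R^o) \o shift x) (h *: v) -
      (f x + k))) =
    (fun h : R => h^-1 *: ((f \o shift x) (h *: v) - f x)).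
  by apply/funext => h /=; rewrite opprD addrACA subrr addr0.
by rewrite /derive E.
Qed.

Lemma derive_line_const {R : realType} {V : normedModType R} (f : V -> R^o)
  (v x : V) : (forall h : R, f (h *: v + x) = f x) -> 'D_v f x = 0.
Proof.
move=> fh; have -> : 'D_v f x = 'D_v (fun=> f x : R^o) x.
  by apply: derive_eq_line => h; rewrite fh.
exact: (derive_cst (f x : R^o)).
Qed.

(** * Leibniz rules up to order three *)

Section Leibniz.
Context {R : realType} {n : nat} (U : set 'rV[R]_n) (oU : open U).
Implicit Types (p q : 'rV[R]_n -> R^o) (a b c : 'I_n).

Lemma partialD p q a y : smooth_on U p -> smooth_on U q -> U y ->
  partial a (fun z => p z + q z) y = partial a p y + partial a q y.
Proof.
move=> sp sq Uy.
exact: (deriveD (smooth_derivable (v := basis_vec a) sp Uy)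
  (smooth_derivable (v := basis_vec a) sq Uy)).
Qed.

Lemma partialM p q a y : smooth_on U p -> smooth_on U q -> U y ->
  partial a (fun z => p z * q z) y = p y * partial a q y + partial a p y * q y.
Proof.
move=> sp sq Uy.
apply: etrans (deriveM (smooth_derivable (v := basis_vec a) sp Uy)
  (smooth_derivable (v := basis_vec a) sq Uy)) _.
by apply: (congr1 (fun t => _ + t)); exact: mulrC.
Qed.

Lemma partial2M p q a b y : smooth_on U p -> smooth_on U q -> U y ->
  partial a (partial b (fun z => p z * q z)) y =
  p y * partial a (partial b q) y + partial a p y * partial b q y +
  (partial b p y * partial a q y + partial a (partial b p) y * q y).
Proof.
move=> sp sq Uy.
have sD := smooth_partial.
apply: etrans (derive_eq_on _ oU Uy (fun z Uz => partialM b sp sq Uz)) _.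
apply: etrans (partialD _ (smoothM oU sp (sD _ _ _ _ b sq))
  (smoothM oU (sD _ _ _ _ b sp) sq) Uy) _.
apply: (congr2 +%R).
  exact: (partialM a sp (sD _ _ _ _ b sq) Uy).
exact: (partialM a (sD _ _ _ _ b sp) sq Uy).
Qed.

Lemma partial3M p q a b c y : smooth_on U p -> smooth_on U q -> U y ->
  partial a (partial b (partial c (fun z => p z * q z))) y =
  p y * partial a (partial b (partial c q)) y
  + partial a p y * partial b (partial c q) y
  + (partial b p y * partial a (partial c q) y
  + partial a (partial b p) y * partial c q y)
  + (partial c p y * partial a (partial b q) y
  + partial a (partial c p) y * partial b q y
  + (partial b (partial c p) y * partial a q y
  + partial a (partial b (partial c p)) y * q y)).
Proof.
move=> sp sq Uy.
have sD := smooth_partial.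
have E z : U z -> partial b (partial c (fun z => p z * q z)) z =
    partial b (fun z => p z * partial c q z) z +
    partial b (fun z => partial c p z * q z) z.
  move=> Uz.
  apply: etrans (derive_eq_on _ oU Uz (fun z Uz => partialM c sp sq Uz)) _.
  exact: (partialD _ (smoothM oU sp (sD _ _ _ _ c sq))
    (smoothM oU (sD _ _ _ _ c sp) sq) Uz).
apply: etrans (derive_eq_on _ oU Uy E) _.
apply: etrans (partialD _ (sD _ _ _ _ b (smoothM oU sp (sD _ _ _ _ c sq)))
  (sD _ _ _ _ b (smoothM oU (sD _ _ _ _ c sp) sq)) Uy) _.
apply: (congr2 +%R).
  exact: (partial2M a b sp (sD _ _ _ _ c sq) Uy).
exact: (partial2M a b (sD _ _ _ _ c sp) sq Uy).
Qed.

(** The derivatives enter as prescribed values, so that each can be supplied in the index order, or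
    with the zero, that the target formula calls for. *)
Lemma partial3M_val p q a b c y (pa pb pc pab pac pbc pabc : R)
    (qa qb qc qab qac qbc qabc : R) :
  smooth_on U p -> smooth_on U q -> U y ->
  partial a p y = pa -> partial b p y = pb -> partial c p y = pc ->
  partial a (partial b p) y = pab -> partial a (partial c p) y = pac ->
  partial b (partial c p) y = pbc -> partial a (partial b (partial c p)) y = pabc ->
  partial a q y = qa -> partial b q y = qb -> partial c q y = qc ->
  partial a (partial b q) y = qab -> partial a (partial c q) y = qac ->
  partial b (partial c q) y = qbc -> partial a (partial b (partial c q)) y = qabc ->
  partial a (partial b (partial c (fun z => p z * q z))) y =
  p y * qabc + pa * qbc + (pb * qac + pab * qc) +
  (pc * qab + pac * qb + (pbc * qa + pabc * q y)).
Proof.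
move=> sp sq Uy <- <- <- <- <- <- <- <- <- <- <- <- <- <-; exact: partial3M.
Qed.

Lemma partial3D p q a b c y : smooth_on U p -> smooth_on U q -> U y ->
  partial a (partial b (partial c (fun z => p z + q z))) y =
  partial a (partial b (partial c p)) y + partial a (partial b (partial c q)) y.
Proof.
move=> sp sq Uy; have sD := smooth_partial.
have E z : U z -> partial b (partial c (fun z => p z + q z)) z =
    partial b (partial c p) z + partial b (partial c q) z.
  move=> Uz.
  apply: etrans (derive_eq_on _ oU Uz (fun z Uz => partialD c sp sq Uz)) _.
  exact: (partialD b (sD _ _ _ _ c sp) (sD _ _ _ _ c sq) Uz).
apply: etrans (derive_eq_on _ oU Uy E) _.
exact: (partialD a (sD _ _ _ _ b (sD _ _ _ _ c sp))
  (sD _ _ _ _ b (sD _ _ _ _ c sq)) Uy).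
Qed.

Lemma partial_cst a (k : R) : partial a (fun _ : 'rV[R]_n => k) = fun=> 0.
Proof. by apply/funext => z; exact: (derive_cst (k : R^o)). Qed.

Lemma partial2_cst a b (k : R) :
  partial a (partial b (fun _ : 'rV[R]_n => k)) = fun=> 0.
Proof. by rewrite partial_cst; exact: partial_cst. Qed.

Lemma partial3_cst a b c (k : R) :
  partial a (partial b (partial c (fun _ : 'rV[R]_n => k))) = fun=> 0.
Proof. by rewrite partial2_cst; exact: partial_cst. Qed.

Lemma partial_mull a (k : R) p :
  partial a (fun z => k * p z) = fun z => k * partial a p z.
Proof. by apply/funext => z; exact: derive_mull. Qed.

Lemma partial2_mull a b (k : R) p :
  partial a (partial b (fun z => k * p z)) = fun z => k * partial a (partial b p) z.
Proof. by rewrite (partial_mull b k p); exact: partial_mull. Qed.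

Lemma partial3_mull a b c (k : R) p :
  partial a (partial b (partial c (fun z => k * p z))) =
  fun z => k * partial a (partial b (partial c p)) z.
Proof. by rewrite (partial2_mull b c k p); exact: partial_mull. Qed.

Lemma partial_linear a (e : 'I_n -> R) :
  partial a (fun z : 'rV[R]_n => \sum_i e i * z 0 i) = fun=> e a.
Proof.
apply/funext => z; apply: etrans (derive_sum_fun _ _) _ => [i|].
  apply: derivableM; first exact: derivable_cst.
  exact: (smooth_derivable (smooth_coord (U := setT) i) I).
under eq_bigr => i _ do rewrite derive_mull derive_coord mxE eqxx/=.
by rewrite (bigD1 a)//= eqxx mulr1 big1 ?addr0// => i /negbTE ->; rewrite mulr0.
Qed.

Lemma partial2_linear a b (e : 'I_n -> R) :
  partial a (partial b (fun z : 'rV[R]_n => \sum_i e i * z 0 i)) = fun=> 0.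
Proof. by rewrite partial_linear; exact: partial_cst. Qed.

Lemma smooth_linear (e : 'I_n -> R) :
  smooth_on U (fun z : 'rV[R]_n => \sum_i e i * z 0 i : R^o).
Proof.
apply: smooth_sum => // i.
by apply: (smoothM oU); [exact: smooth_cst|exact: smooth_coord].
Qed.

Lemma partial_coord a i :
  partial a (fun z : 'rV[R]_n => z 0 i) = fun=> basis_vec a 0 i.
Proof. by apply/funext => z; exact: derive_coord. Qed.

Lemma partial2_coord a b i :
  partial a (partial b (fun z : 'rV[R]_n => z 0 i)) = fun=> 0.
Proof. by rewrite partial_coord; exact: partial_cst. Qed.

End Leibniz.

(** * Functions of two blocks and sums of two products *)

Section Split.
Context {R : realType} {n1 n2 : nat}.
Implicit Types (Y : 'rV[R]_(n1 + n2)) (i : 'I_n1) (j : 'I_n2) (h : R).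

Lemma lsubmx_line_l h i Y : lsubmx (h *: basis_vec (lshift n2 i) + Y) =
  h *: basis_vec i + lsubmx Y.
Proof.
by apply/rowP => k; rewrite !mxE !eqxx (inj_eq (@lshift_inj _ _)).
Qed.

Lemma rsubmx_line_l h i Y : rsubmx (h *: basis_vec (lshift n2 i) + Y) = rsubmx Y.
Proof.
by apply/rowP => k; rewrite !mxE eq_rlshift andbF mulr0 add0r.
Qed.

Lemma lsubmx_line_r h j Y : lsubmx (h *: basis_vec (rshift n1 j) + Y) = lsubmx Y.
Proof.
by apply/rowP => k; rewrite !mxE eq_lrshift andbF mulr0 add0r.
Qed.

Lemma rsubmx_line_r h j Y : rsubmx (h *: basis_vec (rshift n1 j) + Y) =
  h *: basis_vec j + rsubmx Y.
Proof.
by apply/rowP => k; rewrite !mxE !eqxx (inj_eq (@rshift_inj _ _)).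
Qed.

(** The open set on which the spray formulas hold; being open, it lets them be differentiated
    again. *)
Definition slit2 : set 'rV[R]_(n1 + n2) :=
  [set Y | lsubmx Y != 0 /\ rsubmx Y != 0].

Lemma open_slit2 : open slit2.
Proof.
have -> : slit2 = (lsubmx @^-1` slit) `&` (rsubmx @^-1` slit) by [].
by apply: openI; apply: open_comp open_slit => Y _;
  apply: differentiable_continuous; [exact: differentiable_lsubmx|
  exact: differentiable_rsubmx].
Qed.

Section Tensor.
Variables (a c : 'rV[R]_n1 -> R^o) (b d : 'rV[R]_n2 -> R^o)
  (g : 'rV[R]_(n1 + n2) -> R^o).
Hypothesis gE : forall Y, slit2 Y ->
  g Y = a (lsubmx Y) * b (rsubmx Y) + c (lsubmx Y) * d (rsubmx Y).

(** The factors [b] and [d] are constant along the line. The result has again the form of [gE], with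
    [a] and [c] differentiated, so it serves as the hypothesis for the next derivative. *)
Lemma partial_tensor_l i Y : smooth_on slit a -> smooth_on slit c -> slit2 Y ->
  partial (lshift n2 i) g Y =
  partial i a (lsubmx Y) * b (rsubmx Y) + partial i c (lsubmx Y) * d (rsubmx Y).
Proof.
move=> sa sc WY; apply: etrans (derive_eq_on _ open_slit2 WY gE) _.
have [Y1 Y2] := WY.
have T (p : 'rV[R]_n1 -> R^o) (q : 'rV[R]_n2 -> R^o) : smooth_on slit p ->
    derivable (fun Y => p (lsubmx Y) * q (rsubmx Y) : R^o) Y
      (basis_vec (lshift n2 i)) /\
    'D_(basis_vec (lshift n2 i)) (fun Y => p (lsubmx Y) * q (rsubmx Y) : R^o) Y =
    partial i p (lsubmx Y) * q (rsubmx Y).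
  move=> sp.
  have E h : p (lsubmx (h *: basis_vec (lshift n2 i) + Y)) *
      q (rsubmx (h *: basis_vec (lshift n2 i) + Y)) =
      p (h *: basis_vec i + lsubmx Y) * q (rsubmx Y).
    by rewrite lsubmx_line_l rsubmx_line_l.
  split.
    apply: (derivable_eq_line (g := fun y => p y * q (rsubmx Y) : R^o) E).
    apply: derivableM; last exact: derivable_cst.
    exact: smooth_derivable sp Y1.
  apply: etrans (derive_eq_line (g := fun y => p y * q (rsubmx Y) : R^o) E) _.
  exact: derive_mulr.
have [dab <-] := T a b sa; have [dcd <-] := T c d sc.
exact: (deriveD dab dcd).
Qed.

Lemma partial_tensor_r j Y : smooth_on slit b -> smooth_on slit d -> slit2 Y ->
  partial (rshift n1 j) g Y =
  a (lsubmx Y) * partial j b (rsubmx Y) + c (lsubmx Y) * partial j d (rsubmx Y).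
Proof.
move=> sb sd WY; apply: etrans (derive_eq_on _ open_slit2 WY gE) _.
have [Y1 Y2] := WY.
have T (p : 'rV[R]_n1 -> R^o) (q : 'rV[R]_n2 -> R^o) : smooth_on slit q ->
    derivable (fun Y => p (lsubmx Y) * q (rsubmx Y) : R^o) Y
      (basis_vec (rshift n1 j)) /\
    'D_(basis_vec (rshift n1 j)) (fun Y => p (lsubmx Y) * q (rsubmx Y) : R^o) Y =
    p (lsubmx Y) * partial j q (rsubmx Y).
  move=> sq.
  have E h : p (lsubmx (h *: basis_vec (rshift n1 j) + Y)) *
      q (rsubmx (h *: basis_vec (rshift n1 j) + Y)) =
      p (lsubmx Y) * q (h *: basis_vec j + rsubmx Y).
    by rewrite lsubmx_line_r rsubmx_line_r.
  split.
    apply: (derivable_eq_line (g := fun v => p (lsubmx Y) * q v : R^o) E).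
    apply: derivableM; first exact: derivable_cst.
    exact: smooth_derivable sq Y2.
  apply: etrans (derive_eq_line (g := fun v => p (lsubmx Y) * q v : R^o) E) _.
  exact: derive_mull.
have [dab <-] := T a b sb; have [dcd <-] := T c d sd.
exact: (deriveD dab dcd).
Qed.

End Tensor.
End Split.

Lemma invmx_block_diag_scale {R : realType} {n1 n2 : nat} (A : 'M[R]_n1)
  (D : 'M[R]_n2) (k : R) : A \in unitmx -> D \in unitmx -> k != 0 ->
  invmx (block_mx A 0 0 (k *: D)) = block_mx (invmx A) 0 0 (k^-1 *: invmx D).
Proof.
move=> uA uD k0.
have E : block_mx (invmx A) 0 0 (k^-1 *: invmx D) *m block_mx A 0 0 (k *: D) = 1%:M.
  rewrite mulmx_block !mul0mx !mulmx0 !addr0 add0r -scalemxAl -scalemxAr scalerA.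
  by rewrite mulVf// scale1r !mulVmx// -scalar_mx_block.
have [_ uB] := mulmx1_unit E.
by rewrite -[LHS]mul1mx -E mulmxK.
Qed.

(** * The twisted metric *)

Section Twisted.
Context {R : realType} {n1 n2 : nat}.
Variables (F1 : 'rV[R]_n1 -> 'rV[R]_n1 -> R) (F2 : 'rV[R]_n2 -> 'rV[R]_n2 -> R)
  (f : 'rV[R]_(n1 + n2) -> R).

(** The metric [twisted] read in one product chart, with [f] standing for its coordinate
    expression. *)
Definition twist (X Y : 'rV[R]_(n1 + n2)) : R :=
  Num.sqrt (F1 (lsubmx X) (lsubmx Y) ^+ 2 +
            f X ^+ 2 * F2 (rsubmx X) (rsubmx Y) ^+ 2).

Implicit Types (X Y : 'rV[R]_(n1 + n2)) (i j k l : 'I_n1) (al be la g : 'I_n2).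

(** * Fundamental tensor of the twisted metric and its inverse *)

Lemma sqF_twist X Y : sqF twist X Y =
  sqF F1 (lsubmx X) (lsubmx Y) + f X ^+ 2 * sqF F2 (rsubmx X) (rsubmx Y).
Proof.
by rewrite /sqF /twist sqr_sqrtr// addr_ge0 ?sqr_ge0// mulr_ge0 ?sqr_ge0.
Qed.

(** Along a Latin direction the [F2] term is an additive constant, so the formula holds for all [X]
    and [Y], zero fibre vectors included. *)
Lemma dy_sqF_twist_l i X Y : dy (lshift n2 i) (sqF twist) X Y =
  dy i (sqF F1) (lsubmx X) (lsubmx Y).
Proof.
rewrite -[RHS](derive_addr _ _ _ (f X ^+ 2 * sqF F2 (rsubmx X) (rsubmx Y))).
apply: derive_eq_line => h.
by rewrite sqF_twist lsubmx_line_l rsubmx_line_l.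
Qed.

Lemma dy_sqF_twist_r al X Y : dy (rshift n1 al) (sqF twist) X Y =
  f X ^+ 2 * dy al (sqF F2) (rsubmx X) (rsubmx Y).
Proof.
rewrite -[RHS]derive_mull.
rewrite -[RHS](derive_addr _ _ _ (sqF F1 (lsubmx X) (lsubmx Y))).
apply: derive_eq_line => h.
by rewrite sqF_twist lsubmx_line_r rsubmx_line_r addrC.
Qed.

Lemma fund_twist_ll i j X Y : fund twist (lshift n2 i) (lshift n2 j) X Y =
  fund F1 i j (lsubmx X) (lsubmx Y).
Proof.
apply: (congr1 (fun t => 2^-1 * t)).
apply: derive_eq_line => h.
by apply: etrans (dy_sqF_twist_l _ _ _) _; rewrite lsubmx_line_l.
Qed.

(** The inner Greek derivative depends on [Y] through its second block only, hence is constant along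
    a Latin direction. *)
Lemma fund_twist_lr i al X Y : fund twist (lshift n2 i) (rshift n1 al) X Y = 0.
Proof.
rewrite -[RHS](mulr0 2^-1); apply: (congr1 (fun t => 2^-1 * t)).
apply: derive_line_const => h; apply: etrans (dy_sqF_twist_r _ _ _) _.
by rewrite rsubmx_line_l dy_sqF_twist_r.
Qed.

Lemma fund_twist_rl i al X Y : fund twist (rshift n1 al) (lshift n2 i) X Y = 0.
Proof.
rewrite -[RHS](mulr0 2^-1); apply: (congr1 (fun t => 2^-1 * t)).
apply: derive_line_const => h; apply: etrans (dy_sqF_twist_l _ _ _) _.
by rewrite lsubmx_line_r dy_sqF_twist_l.
Qed.

Lemma fund_twist_rr al be X Y : fund twist (rshift n1 al) (rshift n1 be) X Y =
  f X ^+ 2 * fund F2 al be (rsubmx X) (rsubmx Y).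
Proof.
rewrite /fund mulrCA; apply: (congr1 (fun t => 2^-1 * t)).
apply: etrans _ (derive_mull _ _ _ _).
apply: derive_eq_line => h.
by apply: etrans (dy_sqF_twist_r _ _ _) _; rewrite rsubmx_line_r.
Qed.

Lemma fund_mx_twist X Y : fund_mx twist X Y =
  block_mx (fund_mx F1 (lsubmx X) (lsubmx Y)) 0 0
    (f X ^+ 2 *: fund_mx F2 (rsubmx X) (rsubmx Y)).
Proof.
apply/matrixP => a b; rewrite -[a]splitK -[b]splitK.
case: (fintype.split a) => [i|al]; case: (fintype.split b) => [j|be] /=.
- by rewrite block_mxEul !mxE fund_twist_ll.
- by rewrite block_mxEur !mxE fund_twist_lr.
- by rewrite block_mxEdl !mxE fund_twist_rl.
- by rewrite block_mxEdr !mxE fund_twist_rr.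
Qed.

Variables (U1 : set 'rV[R]_n1) (U2 : set 'rV[R]_n2).
Hypotheses (lF1 : local_finsler F1 U1) (lF2 : local_finsler F2 U2).
Variables (x : 'rV[R]_n1) (u : 'rV[R]_n2).
Hypotheses (Ux : U1 x) (Uu : U2 u).
Let X := row_mx x u.
Hypotheses (f0 : f X != 0)
  (df : forall a, derivable (f : _ -> R^o) X (basis_vec a)).
Let d1 i : R := partial (lshift n2 i) f X.
Let d2 al : R := partial (rshift n1 al) f X.
Let oW : open (@slit2 R n1 n2) := open_slit2.

Let lX : lsubmx X = x. Proof. exact: row_mxKl. Qed.
Let rX : rsubmx X = u. Proof. exact: row_mxKr. Qed.
Let f20 : f X ^+ 2 != 0. Proof. by rewrite expf_neq0. Qed.

Lemma invmx_fund_twist Y : slit2 Y -> invmx (fund_mx twist X Y) =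
  block_mx (invmx (fund_mx F1 x (lsubmx Y))) 0 0
    ((f X ^+ 2)^-1 *: invmx (fund_mx F2 u (rsubmx Y))).
Proof.
move=> [Y1 Y2]; rewrite fund_mx_twist lX rX invmx_block_diag_scale//.
- exact: fund_mx_unit lF1 _ Ux _ Y1.
- exact: fund_mx_unit lF2 _ Uu _ Y2.
Qed.

Lemma fund_inv_twist_ll k i Y : slit2 Y ->
  fund_inv twist (lshift n2 k) (lshift n2 i) X Y = fund_inv F1 k i x (lsubmx Y).
Proof. by move=> WY; rewrite /fund_inv invmx_fund_twist// block_mxEul. Qed.

Lemma fund_inv_twist_lr k al Y : slit2 Y ->
  fund_inv twist (lshift n2 k) (rshift n1 al) X Y = 0.
Proof. by move=> WY; rewrite /fund_inv invmx_fund_twist// block_mxEur mxE. Qed.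

Lemma fund_inv_twist_rl al k Y : slit2 Y ->
  fund_inv twist (rshift n1 al) (lshift n2 k) X Y = 0.
Proof. by move=> WY; rewrite /fund_inv invmx_fund_twist// block_mxEdl mxE. Qed.

Lemma fund_inv_twist_rr al be Y : slit2 Y ->
  fund_inv twist (rshift n1 al) (rshift n1 be) X Y =
  (f X ^+ 2)^-1 * fund_inv F2 al be u (rsubmx Y).
Proof. by move=> WY; rewrite /fund_inv invmx_fund_twist// block_mxEdr mxE. Qed.

(** * Base derivatives of the squared metric *)

Let df2 a : derivable (fun X' => f X' ^+ 2 : R^o) X (basis_vec a) /\
  'D_(basis_vec a) (fun X' => f X' ^+ 2 : R^o) X = 2 * f X * partial a f X.
Proof.
have -> : (fun X' => f X' ^+ 2 : R^o) = (f : _ -> R^o) * (f : _ -> R^o).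
  by apply/funext => X'; rewrite expr2.
split; first exact: (derivableM (@df a) (@df a)).
apply: etrans (deriveM (@df a) (@df a)) _.
by rewrite -mulrA mulrDl mul1r.
Qed.

Lemma dx_sqF_twist_l i Y : slit2 Y -> dx (lshift n2 i) (sqF twist) X Y =
  dx i (sqF F1) x (lsubmx Y) + 2 * f X * d1 i * sqF F2 u (rsubmx Y).
Proof.
move=> [Y1 Y2].
have E1 h : sqF F1 (lsubmx (h *: basis_vec (lshift n2 i) + X)) (lsubmx Y) =
    sqF F1 (h *: basis_vec i + x) (lsubmx Y).
  by rewrite lsubmx_line_l lX.
have E2 h : f (h *: basis_vec (lshift n2 i) + X) ^+ 2 *
      sqF F2 (rsubmx (h *: basis_vec (lshift n2 i) + X)) (rsubmx Y) =
    f (h *: basis_vec (lshift n2 i) + X) ^+ 2 * sqF F2 u (rsubmx Y).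
  by rewrite rsubmx_line_l rX.
have D1 := derivable_eq_line
  (f := fun X' => sqF F1 (lsubmx X') (lsubmx Y) : R^o)
  (g := fun z => sqF F1 z (lsubmx Y) : R^o) E1
  (derivable_sqF_base lF1 Ux (c := i) Y1).
have D2 := derivable_eq_line
  (f := fun X' => f X' ^+ 2 * sqF F2 (rsubmx X') (rsubmx Y) : R^o)
  (g := fun X' => f X' ^+ 2 * sqF F2 u (rsubmx Y) : R^o) E2
  (derivableM (df2 _).1 (derivable_cst (_ : R^o) _ _)).
have -> : dx (lshift n2 i) (sqF twist) X Y =
    'D_(basis_vec (lshift n2 i)) ((fun X' => sqF F1 (lsubmx X') (lsubmx Y) : R^o) +
    (fun X' => f X' ^+ 2 * sqF F2 (rsubmx X') (rsubmx Y) : R^o)) X.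
  by apply: derive_eq_line => h; exact: sqF_twist.
apply: etrans (deriveD D1 D2) _; apply: (congr2 +%R).
  exact: (derive_eq_line (g := fun z => sqF F1 z (lsubmx Y) : R^o) E1).
apply: etrans (derive_eq_line
  (g := fun X' => f X' ^+ 2 * sqF F2 u (rsubmx Y) : R^o) E2) _.
by apply: etrans (derive_mulr _ _ _ _) _; rewrite (df2 _).2.
Qed.

Lemma dx_sqF_twist_r al Y : slit2 Y -> dx (rshift n1 al) (sqF twist) X Y =
  f X ^+ 2 * dx al (sqF F2) u (rsubmx Y) + 2 * f X * d2 al * sqF F2 u (rsubmx Y).
Proof.
move=> [Y1 Y2].
have E1 h : sqF twist (h *: basis_vec (rshift n1 al) + X) Y =
    f (h *: basis_vec (rshift n1 al) + X) ^+ 2 *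
      sqF F2 (rsubmx (h *: basis_vec (rshift n1 al) + X)) (rsubmx Y) +
    sqF F1 x (lsubmx Y).
  by rewrite sqF_twist lsubmx_line_r lX addrC.
have E2 h : sqF F2 (rsubmx (h *: basis_vec (rshift n1 al) + X)) (rsubmx Y) =
    sqF F2 (h *: basis_vec al + u) (rsubmx Y).
  by rewrite rsubmx_line_r rX.
have D2 := derivable_eq_line
  (f := fun X' => sqF F2 (rsubmx X') (rsubmx Y) : R^o)
  (g := fun z => sqF F2 z (rsubmx Y) : R^o) E2
  (derivable_sqF_base lF2 Uu (c := al) Y2).
apply: etrans (derive_eq_line (f := (sqF twist)^~ Y : _ -> R^o)
  (g := fun X' => f X' ^+ 2 * sqF F2 (rsubmx X') (rsubmx Y) +
    sqF F1 x (lsubmx Y) : R^o) E1) _.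
apply: etrans (derive_addr _ _ _ _) _.
apply: etrans (deriveM (df2 _).1 D2) _; apply: (congr2 +%R).
  apply: (congr1 (fun t => f X ^+ 2 * t)).
  exact: (derive_eq_line (g := fun z => sqF F2 z (rsubmx Y) : R^o) E2).
apply: etrans (mulrC _ _) _; rewrite (df2 _).2.
by rewrite rX.
Qed.

Lemma dy_dx_sqF_twist_ll i j Y : slit2 Y ->
  dy (lshift n2 i) (dx (lshift n2 j) (sqF twist)) X Y =
  dy i (dx j (sqF F1)) x (lsubmx Y).
Proof.
move=> WY; apply: etrans (derive_eq_on _ oW WY (dx_sqF_twist_l j)) _.
apply: etrans _ (derive_addr _ _ _ (2 * f X * d1 j * sqF F2 u (rsubmx Y))).
by apply: derive_eq_line => h; rewrite lsubmx_line_l rsubmx_line_l.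
Qed.

Lemma dy_dx_sqF_twist_lr i al Y : slit2 Y ->
  dy (lshift n2 i) (dx (rshift n1 al) (sqF twist)) X Y = 0.
Proof.
move=> WY; apply: etrans (derive_eq_on _ oW WY (dx_sqF_twist_r al)) _.
by apply: derive_line_const => h; rewrite rsubmx_line_l.
Qed.

(** The twist couples the two blocks here: [f] depends on [x] and multiplies [F2^2]. This produces
    the mixed part of [G^gamma]. *)
Lemma dy_dx_sqF_twist_rl al i Y : slit2 Y ->
  dy (rshift n1 al) (dx (lshift n2 i) (sqF twist)) X Y =
  2 * f X * d1 i * dy al (sqF F2) u (rsubmx Y).
Proof.
move=> WY; apply: etrans (derive_eq_on _ oW WY (dx_sqF_twist_l i)) _.
apply: etrans _ (derive_mull _ _ _ _).
apply: etrans _ (derive_addr _ _ _ (dx i (sqF F1) x (lsubmx Y))).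
by apply: derive_eq_line => h; rewrite lsubmx_line_r rsubmx_line_r addrC.
Qed.

Lemma dy_dx_sqF_twist_rr al be Y : slit2 Y ->
  dy (rshift n1 al) (dx (rshift n1 be) (sqF twist)) X Y =
  f X ^+ 2 * dy al (dx be (sqF F2)) u (rsubmx Y) +
  2 * f X * d2 be * dy al (sqF F2) u (rsubmx Y).
Proof.
move=> WY; apply: etrans (derive_eq_on _ oW WY (dx_sqF_twist_r be)) _.
have [_ Y2] := WY.
pose p v : R^o := f X ^+ 2 * dx be (sqF F2) u v.
pose q v : R^o := 2 * f X * d2 be * sqF F2 u v.
have sp : smooth_on slit p.
  apply: (smoothM open_slit); first exact: smooth_cst.
  exact: smooth_dx_sqF lF2 _ Uu be.
have sq : smooth_on slit q.
  apply: (smoothM open_slit); first exact: smooth_cst.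
  exact: smooth_sqF lF2 _ Uu.
transitivity (partial al (fun v => p v + q v) (rsubmx Y)).
  by apply: derive_eq_line => h; rewrite rsubmx_line_r.
apply: etrans (partialD _ sp sq Y2) _.
by apply: (congr2 +%R); exact: derive_mull.
Qed.

(** * Spray coefficients *)

Let up1 k (y : 'rV[R]_n1) : R^o := \sum_i fund_inv F1 k i x y * d1 i.
Let up2 g (v : 'rV[R]_n2) : R^o := \sum_al fund_inv F2 g al u v * d2 al.
Let lin1 (y : 'rV[R]_n1) : R^o := \sum_i d1 i * y 0 i.
Let lin2 (v : 'rV[R]_n2) : R^o := \sum_al d2 al * v 0 al.

Let lsubmxE Y i : Y 0 (lshift n2 i) = lsubmx Y 0 i. Proof. by rewrite mxE. Qed.
Let rsubmxE Y al : Y 0 (rshift n1 al) = rsubmx Y 0 al. Proof. by rewrite mxE. Qed.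

(** The factor [1] gives the sum the shape of [gE]. The constant [- 2^-1] is [4^-1] times the [- 2]
    in [- 2 f f_i F2^2], which the base derivative of [F^2] leaves. *)
Lemma spray_twist_l k Y : slit2 Y -> spray twist (lshift n2 k) X Y =
  spray F1 k x (lsubmx Y) * 1 +
  up1 k (lsubmx Y) * (- 2^-1 * f X * sqF F2 u (rsubmx Y)).
Proof.
move=> WY; rewrite /spray big_split_ord/= [X in _ + X]big1 ?addr0; last first.
  by move=> al _; rewrite fund_inv_twist_lr// mul0r.
pose S i := (\sum_c dy i (dx c (sqF F1)) x (lsubmx Y) * lsubmx Y 0 c) -
  dx i (sqF F1) x (lsubmx Y).
have E i : fund_inv twist (lshift n2 k) (lshift n2 i) X Y *
   ((\sum_c dy (lshift n2 i) (dx c (sqF twist)) X Y * Y 0 c) -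
     dx (lshift n2 i) (sqF twist) X Y) =
   fund_inv F1 k i x (lsubmx Y) * S i +
   fund_inv F1 k i x (lsubmx Y) * d1 i * (- 2 * f X * sqF F2 u (rsubmx Y)).
  rewrite fund_inv_twist_ll// dx_sqF_twist_l// big_split_ord/=.
  rewrite [X in _ + X - _]big1 ?addr0; last first.
    by move=> al _; rewrite dy_dx_sqF_twist_lr// mul0r.
  under eq_bigr => c _ do rewrite dy_dx_sqF_twist_ll// lsubmxE.
  by rewrite /S; ring.
under eq_bigr => i _ do rewrite E.
rewrite big_split/= -mulr_suml -/(up1 k (lsubmx Y)) mulrDr mulr1.
by apply: (congr2 +%R) => //; field.
Qed.

(** Differentiating [f^2] along the fibre vector and pairing with the gradient [2 v_al] gives
    [4 f (lin1 + lin2) v_al]; the factors [4^-1] and [f^-2] leave [f^-1], and raising the index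
    turns [v_al] into [v^g]. Only the [lin1] term mixes [y] and [v], so it forms the second
    product. *)
Lemma spray_twist_r g Y : slit2 Y -> spray twist (rshift n1 g) X Y =
  1 * (spray F2 g u (rsubmx Y)
       + (f X)^-1 * (lin2 (rsubmx Y) * rsubmx Y 0 g)
       + (- 2^-1 * (f X)^-1) * (sqF F2 u (rsubmx Y) * up2 g (rsubmx Y)))
  + lin1 (lsubmx Y) * ((f X)^-1 * rsubmx Y 0 g).
Proof.
move=> WY; have [_ Y2] := WY.
rewrite /spray big_split_ord/= [X in X + _]big1 ?add0r; last first.
  by move=> i _; rewrite fund_inv_twist_rl// mul0r.
pose S al := (\sum_c dy al (dx c (sqF F2)) u (rsubmx Y) * rsubmx Y 0 c) -
  dx al (sqF F2) u (rsubmx Y).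
have E al : fund_inv twist (rshift n1 g) (rshift n1 al) X Y *
   ((\sum_c dy (rshift n1 al) (dx c (sqF twist)) X Y * Y 0 c) -
     dx (rshift n1 al) (sqF twist) X Y) =
   fund_inv F2 g al u (rsubmx Y) * S al +
   fund_inv F2 g al u (rsubmx Y) * fib_low F2 al u (rsubmx Y) *
     (4 * (f X)^-1 * (lin1 (lsubmx Y) + lin2 (rsubmx Y))) +
   fund_inv F2 g al u (rsubmx Y) * d2 al *
     (- 2 * (f X)^-1 * sqF F2 u (rsubmx Y)).
  rewrite fund_inv_twist_rr// dx_sqF_twist_r// big_split_ord/=.
  have -> : \sum_c dy (rshift n1 al) (dx (lshift n2 c) (sqF twist)) X Y *
      Y 0 (lshift n2 c) =
      lin1 (lsubmx Y) * (2 * f X * (2 * fib_low F2 al u (rsubmx Y))).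
    rewrite /lin1 mulr_suml; apply: eq_bigr => c _.
    rewrite dy_dx_sqF_twist_rl// lsubmxE (dy_sqF_fib_low lF2 Uu _ Y2).
    by ring.
  have -> : \sum_c dy (rshift n1 al) (dx (rshift n1 c) (sqF twist)) X Y *
      Y 0 (rshift n1 c) =
      f X ^+ 2 * (\sum_c dy al (dx c (sqF F2)) u (rsubmx Y) * rsubmx Y 0 c) +
      lin2 (rsubmx Y) * (2 * f X * (2 * fib_low F2 al u (rsubmx Y))).
    rewrite /lin2 mulr_suml mulr_sumr -big_split/=; apply: eq_bigr => c _.
    rewrite dy_dx_sqF_twist_rr// rsubmxE (dy_sqF_fib_low lF2 Uu _ Y2).
    by ring.
  rewrite /S; set s := \sum_c _.
  by field.
under eq_bigr => al _ do rewrite E.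
rewrite !big_split/= -!mulr_suml -/(up2 g (rsubmx Y)).
rewrite (fund_inv_fib_low lF2 Uu _ Y2).
by field.
Qed.

Let sD {n} (i : 'I_n) p := @smooth_partial R n slit p i.
Let smooth_up1 k : smooth_on slit (up1 k).
Proof. exact: smooth_raised lF1 _ Ux d1 k. Qed.
Let smooth_up2 g : smooth_on slit (up2 g).
Proof. exact: smooth_raised lF2 _ Uu d2 g. Qed.
Let c1 {n} : smooth_on (@slit R n) (fun=> 1 : R^o). Proof. exact: smooth_cst. Qed.
Let sprayF1 k : smooth_on slit (spray F1 k x : _ -> R^o).
Proof. exact: smooth_spray lF1 _ Ux k. Qed.
Let sprayF2 g : smooth_on slit (spray F2 g u : _ -> R^o).
Proof. exact: smooth_spray lF2 _ Uu g. Qed.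
(** The [v]-factor of [f^k] in [G^k]; its derivatives are multiples of [v_be], [g_{al be}] and
    [C_{al be la}]. *)
Let q (v : 'rV[R]_n2) : R^o := - 2^-1 * f X * sqF F2 u v.
Let smooth_q : smooth_on slit q.
Proof.
apply: (smoothM open_slit); [exact: smooth_cst|exact: smooth_sqF lF2 _ Uu].
Qed.
(** The [v]-factors of [G^gamma]: [b2] is paired with the constant [1], [e2] with the linear form
    [lin1]. *)
Let b2 g (v : 'rV[R]_n2) : R^o := spray F2 g u v
  + (f X)^-1 * (lin2 v * v 0 g)
  + (- 2^-1 * (f X)^-1) * (sqF F2 u v * up2 g v).
Let e2 g (v : 'rV[R]_n2) : R^o := (f X)^-1 * v 0 g.

Let smooth_quad g : smooth_on slit (fun v => (f X)^-1 * (lin2 v * v 0 g) : R^o).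
Proof.
apply: (smoothM open_slit); first exact: smooth_cst.
by apply: (smoothM open_slit); [exact: (smooth_linear open_slit)|exact: smooth_coord].
Qed.

Let smooth_rest g :
  smooth_on slit (fun v => (- 2^-1 * (f X)^-1) * (sqF F2 u v * up2 g v) : R^o).
Proof.
apply: (smoothM open_slit); first exact: smooth_cst.
by apply: (smoothM open_slit); [exact: smooth_sqF lF2 _ Uu|exact: smooth_up2].
Qed.

Let smooth_b2 g : smooth_on slit (b2 g).
Proof.
apply: (smoothD open_slit); last exact: smooth_rest.
by apply: (smoothD open_slit); [exact: sprayF2|exact: smooth_quad].
Qed.

Let smooth_e2 g : smooth_on slit (e2 g).
Proof.
by apply: (smoothM open_slit); [exact: smooth_cst|exact: smooth_coord].
Qed.

(** * Berwald coefficients, block by block *)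

Variables (y : 'rV[R]_n1) (v : 'rV[R]_n2).
Hypotheses (y0 : y != 0) (v0 : v != 0).
Let Y := row_mx y v.
Let lY : lsubmx Y = y. Proof. exact: row_mxKl. Qed.
Let rY : rsubmx Y = v. Proof. exact: row_mxKr. Qed.
Let WY : slit2 Y. Proof. by rewrite /slit2/= lY rY. Qed.

Let tensor_eq (a b c d a' b' c' d' : R) : a = a' -> b = b' -> c = c' -> d = d' ->
  a * b + c * d = a' * b' + c' * d'.
Proof. by move=> -> -> -> ->. Qed.

Let tensor_0 (a b c d : R) : a = 0 -> c * d = 0 -> a * b + c * d = 0.
Proof. by move=> -> ->; rewrite mul0r add0r. Qed.

Let tensor_l (a b c d b' : R) : a = 1 -> b = b' -> d = 0 ->
  a * b + c * d = b'.
Proof. by move=> -> -> ->; rewrite mulr0 addr0 mul1r. Qed.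

Let tensor_r (a b c d c' d' : R) : b = 0 -> c = c' -> d = d' ->
  a * b + c * d = c' * d'.
Proof. by move=> -> -> ->; rewrite mulr0 add0r. Qed.

Let partial_q be : partial be q v = - f X * fib_low F2 be u v.
Proof.
apply: etrans (congr1 (fun p => p v) (partial_mull _ _ (sqF F2 u))) _.
apply: etrans (congr1 (fun t => _ * t) (dy_sqF_fib_low lF2 Uu be v0)) _.
by field.
Qed.

Let partial2_q al be : partial al (partial be q) v = - f X * fund F2 al be u v.
Proof.
apply: etrans (congr1 (fun p => p v) (partial2_mull _ _ _ (sqF F2 u))) _.
by rewrite /fund mulrA; apply: (congr1 (fun t => t * _)); field.
Qed.

Let partial3_q al be la :
  partial al (partial be (partial la q)) v = - 2 * f X * cartan F2 al be la u v.
Proof.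
apply: etrans (congr1 (fun p => p v) (partial3_mull _ _ _ _ (sqF F2 u))) _.
apply: etrans (congr1 (fun t => _ * t) (dy3_sqF lF2 Uu al be la v0)) _.
by field.
Qed.

Let partial2_e2 al be g : partial al (partial be (e2 g)) v = 0.
Proof.
apply: etrans (congr1 (fun p => p v) (partial2_mull _ _ _ (fun z => z 0 g))) _.
by rewrite partial2_coord mulr0.
Qed.

Let partial3_e2 al be la g : partial al (partial be (partial la (e2 g))) v = 0.
Proof.
apply: etrans (congr1 (fun p => p v) (partial3_mull _ _ _ _ (fun z => z 0 g))) _.
by rewrite partial2_coord partial_cst mulr0.
Qed.

Lemma berwald_twist_lll k i j l :
  berwald twist (lshift n2 k) (lshift n2 i) (lshift n2 j) (lshift n2 l) X Y =
  berwald F1 k i j l x y +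
  f X * (\sum_h dy i (dy j (cartan_up F1 k h l)) x y * d1 h) * sqF F2 u v.
Proof.
(* Read from the inside out: each application yields the decomposition that the next one
   differentiates. *)
apply: etrans (partial_tensor_l (fun Y WY => partial_tensor_l (fun Y WY =>
  partial_tensor_l (b := fun=> 1) (d := q) (spray_twist_l k) l (sprayF1 k) (smooth_up1 k) WY)
  j (sD l (sprayF1 k)) (sD l (smooth_up1 k)) WY)
  i (sD j (sD l (sprayF1 k))) (sD j (sD l (smooth_up1 k))) WY) _.
rewrite lY rY.
transitivity (berwald F1 k i j l x y * 1 +
  (- 2 * \sum_h dy i (dy j (cartan_up F1 k h l)) x y * d1 h) *
  (- 2^-1 * f X * sqF F2 u v)); last by field.
exact: (tensor_eq erefl erefl (partial3_raised lF1 Ux d1 k i j l y0) erefl).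
Qed.

(** The Greek derivative kills the product with factor [1]. As [i] is differentiated after [l], the
    other product yields [C_{l;i}], which [cartan_up_sum_sym] turns into the [C_{i;l}] of the
    statement. *)
Lemma berwald_twist_lrl k i be l :
  berwald twist (lshift n2 k) (lshift n2 i) (rshift n1 be) (lshift n2 l) X Y =
  2 * f X * (\sum_h dy l (cartan_up F1 k h i) x y * d1 h) * fib_low F2 be u v.
Proof.
apply: etrans (partial_tensor_l (fun Y WY => partial_tensor_r (fun Y WY =>
  partial_tensor_l (spray_twist_l k) l (sprayF1 k) (smooth_up1 k) WY)
  be c1 smooth_q WY)
  i (sD l (sprayF1 k)) (sD l (smooth_up1 k)) WY) _.
rewrite lY rY.
apply: etrans (tensor_r _ (congr1 (fun p => p v) (partial_cst _ _))
  (etrans (partial2_raised lF1 Ux d1 k i l y0)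
    (congr1 (fun t => - 2 * t) (cartan_up_sum_sym lF1 Ux d1 k i l y0)))
  (partial_q be)) _.
by ring.
Qed.

Lemma berwald_twist_rrl k al be l :
  berwald twist (lshift n2 k) (rshift n1 al) (rshift n1 be) (lshift n2 l) X Y =
  2 * f X * fund F2 al be u v * (\sum_h cartan_up F1 k h l x y * d1 h).
Proof.
apply: etrans (partial_tensor_r (fun Y WY => partial_tensor_r (fun Y WY =>
  partial_tensor_l (spray_twist_l k) l (sprayF1 k) (smooth_up1 k) WY)
  be c1 smooth_q WY)
  al (sD be c1) (sD be smooth_q) WY) _.
rewrite lY rY.
apply: etrans (tensor_r _ (congr1 (fun p => p v) (partial2_cst _ _ _))
  (partial_raised lF1 Ux d1 k l y0) (partial2_q al be)) _.
by ring.
Qed.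

(** With no Latin derivative [f^k] stays as it is, while three Greek ones turn [F2^2] into four
    times the Cartan tensor. *)
Lemma berwald_twist_l_rrr k al be la :
  berwald twist (lshift n2 k) (rshift n1 al) (rshift n1 be) (rshift n1 la) X Y =
  - 2 * f X * cartan F2 al be la u v * up1 k y.
Proof.
apply: etrans (partial_tensor_r (fun Y WY => partial_tensor_r (fun Y WY =>
  partial_tensor_r (spray_twist_l k) la c1 smooth_q WY)
  be (sD la c1) (sD la smooth_q) WY)
  al (sD be (sD la c1)) (sD be (sD la smooth_q)) WY) _.
rewrite lY rY.
apply: etrans (tensor_r _ (congr1 (fun p => p v) (partial3_cst _ _ _ _))
  erefl (partial3_q al be la)) _.
exact: mulrC.
Qed.

(** The Latin derivative kills [1] and makes [lin1] constant; the partner of [lin1] is linear in [v]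
    and vanishes after two Greek derivatives. *)
Lemma berwald_twist_r_lrr g i be la :
  berwald twist (rshift n1 g) (lshift n2 i) (rshift n1 be) (rshift n1 la) X Y = 0.
Proof.
apply: etrans (partial_tensor_l (b := partial be (partial la (b2 g)))
  (d := partial be (partial la (e2 g)))
  (fun Y WY => partial_tensor_r (fun Y WY =>
  partial_tensor_r (spray_twist_r g) la (smooth_b2 g) (smooth_e2 g) WY)
  be (sD la (smooth_b2 g)) (sD la (smooth_e2 g)) WY)
  i c1 (smooth_linear open_slit d1) WY) _.
rewrite lY rY.
apply: (tensor_0 _ (congr1 (fun p => p y) (partial_cst _ _))).
apply: etrans (congr1 (fun t => _ * t) (partial2_e2 be la g)) _.
exact: mulr0.
Qed.

(** Two Latin derivatives annihilate both [y]-factors, the constant and the linear form. *)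
Lemma berwald_twist_r_llr g i j la :
  berwald twist (rshift n1 g) (lshift n2 i) (lshift n2 j) (rshift n1 la) X Y = 0.
Proof.
apply: etrans (partial_tensor_l (fun Y WY => partial_tensor_l (fun Y WY =>
  partial_tensor_r (spray_twist_r g) la (smooth_b2 g) (smooth_e2 g) WY)
  j c1 (smooth_linear open_slit d1) WY)
  i (sD j c1) (sD j (smooth_linear open_slit d1)) WY) _.
rewrite lY rY.
apply: (tensor_0 _ (congr1 (fun p => p y) (partial2_cst _ _ _))).
apply: etrans (congr1 (fun p => p y * _) (partial2_linear _ _ _)) _.
exact: mul0r.
Qed.

Lemma berwald_twist_r_lll g i j k :
  berwald twist (rshift n1 g) (lshift n2 i) (lshift n2 j) (lshift n2 k) X Y = 0.
Proof.
apply: etrans (partial_tensor_l (fun Y WY => partial_tensor_l (fun Y WY =>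
  partial_tensor_l (b := b2 g) (d := e2 g)
    (spray_twist_r g) k c1 (smooth_linear open_slit d1) WY)
  j (sD k c1) (sD k (smooth_linear open_slit d1)) WY)
  i (sD j (sD k c1)) (sD j (sD k (smooth_linear open_slit d1))) WY) _.
rewrite lY rY.
apply: (tensor_0 _ (congr1 (fun p => p y) (partial3_cst _ _ _ _))).
apply: etrans (congr1 (fun p => p y * _) (etrans
  (congr1 (partial i) (partial2_linear j k d1)) (partial_cst _ _))) _.
exact: mul0r.
Qed.

(** Three derivatives shared between two linear factors: one factor receives at least two of them,
    so every Leibniz term vanishes. *)
Let quad0 (k l m a b c a' b' c' : R) :
  k * (l * 0 + a * 0 + (b * 0 + 0 * c') + (c * 0 + 0 * b' + (0 * a' + 0 * m))) = 0.
Proof. by ring. Qed.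

(** Leibniz' rule for [F2^2] times [f^g], with prefactor [- 2^-1]: an undifferentiated [F2^2] comes
    with [- 2], giving coefficient [1]; the mixed terms with [2 * (- 2)], giving [2]; an
    undifferentiated [f^g] with [4], giving [- 2]. *)
Let collect (k B D La Lb Lc Cbc Cca Cba Ca Cb Cc Gab Gca Gcb T P : R) :
  (- 2^-1 * k) * (B * (- 2 * D) + (2 * La) * (- 2 * Cbc) +
    ((2 * Lb) * (- 2 * Cca) + (2 * Gab) * (- 2 * Cc)) +
    ((2 * Lc) * (- 2 * Cba) + (2 * Gca) * (- 2 * Cb) +
    ((2 * Gcb) * (- 2 * Ca) + (4 * T) * P))) =
  k * (D * B + 2 * Cba * Lc + 2 * Cca * Lb + 2 * Ca * Gcb + 2 * Cbc * La
       + 2 * Cb * Gca + 2 * Cc * Gab - 2 * T * P).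
Proof. by field. Qed.

(** In [G^gamma] the [lin1] and [lin2] terms are at most quadratic in [v], so besides the spray of
    [F2] only the product of [F2^2] and [f^gamma] contributes. *)
Lemma berwald_twist_rrr g al be la :
  berwald twist (rshift n1 g) (rshift n1 al) (rshift n1 be) (rshift n1 la) X Y =
  berwald F2 g al be la u v + (f X)^-1 *
   ((\sum_h dy be (dy al (cartan_up F2 g h la)) u v * d2 h) * sqF F2 u v
    + 2 * (\sum_h dy be (cartan_up F2 g h al) u v * d2 h) * fib_low F2 la u v
    + 2 * (\sum_h dy la (cartan_up F2 g h al) u v * d2 h) * fib_low F2 be u v
    + 2 * (\sum_h cartan_up F2 g h al u v * d2 h) * fund F2 la be u v
    + 2 * (\sum_h dy be (cartan_up F2 g h la) u v * d2 h) * fib_low F2 al u v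
    + 2 * (\sum_h cartan_up F2 g h be u v * d2 h) * fund F2 la al u v
    + 2 * (\sum_h cartan_up F2 g h la u v * d2 h) * fund F2 al be u v
    - 2 * cartan F2 al be la u v * up2 g v).
Proof.
apply: etrans (partial_tensor_r (fun Y WY => partial_tensor_r (fun Y WY =>
  partial_tensor_r (spray_twist_r g) la (smooth_b2 g) (smooth_e2 g) WY)
  be (sD la (smooth_b2 g)) (sD la (smooth_e2 g)) WY)
  al (sD be (sD la (smooth_b2 g))) (sD be (sD la (smooth_e2 g))) WY) _.
rewrite lY rY.
apply: etrans (tensor_l _ (erefl (1 : R)) erefl (partial3_e2 al be la g)) _.
apply: etrans (partial3D open_slit _ _ _
  (smoothD open_slit (sprayF2 g) (smooth_quad g)) (smooth_rest g) v0) _.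
apply: (congr2 +%R).
  apply: etrans (partial3D open_slit _ _ _ (sprayF2 g) (smooth_quad g) v0) _.
  rewrite -[RHS]addr0; apply: (congr2 +%R); first reflexivity.
  apply: etrans (congr1 (fun p => p v)
    (partial3_mull _ _ _ _ (fun z => lin2 z * z 0 g))) _.
  have L2 a b : partial a (partial b lin2) v = 0.
    exact: (congr1 (fun p => p v) (partial2_linear a b d2)).
  have L3 a b c : partial a (partial b (partial c lin2)) v = 0.
    exact: (congr1 (fun p => p v) (etrans (congr1 (partial a)
      (partial2_linear b c d2)) (partial_cst _ _))).
  have K2 a b : partial a (partial b (fun z => z 0 g)) v = 0.
    exact: (congr1 (fun p => p v) (partial2_coord a b g)).
  have K3 a b c : partial a (partial b (partial c (fun z => z 0 g))) v = 0.
    exact: (congr1 (fun p => p v) (etrans (congr1 (partial a)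
      (partial2_coord b c g)) (partial_cst _ _))).
  apply: etrans (congr1 (fun t => _ * t) (partial3M_val open_slit
    (smooth_linear open_slit d2) (smooth_coord g) v0 erefl erefl erefl
    (L2 _ _) (L2 _ _) (L2 _ _) (L3 _ _ _) erefl erefl erefl
    (K2 _ _) (K2 _ _) (K2 _ _) (K3 _ _ _))) _.
  exact: quad0.
apply: etrans (congr1 (fun p => p v)
  (partial3_mull _ _ _ _ (fun z => sqF F2 u z * up2 g z))) _.
have P1 a : partial a (up2 g) v = - 2 * \sum_h cartan_up F2 g h a u v * d2 h.
  exact: (partial_raised lF2 Uu d2 g a v0).
have P2 a b : partial a (partial b (up2 g)) v =
    - 2 * \sum_h dy a (cartan_up F2 g h b) u v * d2 h.
  exact: (partial2_raised lF2 Uu d2 g a b v0).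
(* The target contains [C_{al;be}] and [C_{al;la}] where the nesting of derivatives yields
   [C_{be;al}] and [C_{la;al}]. *)
have P2' a b : partial a (partial b (up2 g)) v =
    - 2 * \sum_h dy b (cartan_up F2 g h a) u v * d2 h.
  exact: (etrans (P2 a b) (congr1 (fun t => - 2 * t)
    (cartan_up_sum_sym lF2 Uu d2 g a b v0))).
have P3 : partial al (partial be (partial la (up2 g))) v = - 2 *
    \sum_h dy be (dy al (cartan_up F2 g h la)) u v * d2 h.
  exact: (etrans (partial3_raised lF2 Uu d2 g al be la v0)
    (congr1 (fun t => - 2 * t) (dy2_cartan_up_sum_sym lF2 Uu d2 g al be la v0))).
have B1 a : partial a (sqF F2 u) v = 2 * fib_low F2 a u v.
  exact: (dy_sqF_fib_low lF2 Uu a v0).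
have B2 a b : partial a (partial b (sqF F2 u)) v = 2 * fund F2 a b u v.
  by rewrite /fund mulrA mulfV ?pnatr_eq0// mul1r.
have B2' a b : partial a (partial b (sqF F2 u)) v = 2 * fund F2 b a u v.
  exact: (etrans (B2 a b) (congr1 (fun t => 2 * t) (fund_sym lF2 Uu a b v0))).
have B3 : partial al (partial be (partial la (sqF F2 u))) v =
    4 * cartan F2 al be la u v by exact: (dy3_sqF lF2 Uu al be la v0).
apply: etrans (congr1 (fun t => _ * t) (partial3M_val open_slit
  (smooth_sqF lF2 Uu) (smooth_up2 g) v0 (B1 _) (B1 _) (B1 _) (B2 _ _) (B2' _ _)
  (B2' _ _) B3 (P1 _) (P1 _) (P1 _) (P2' _ _) (P2' _ _) (P2 _ _) P3)) _.
exact: collect.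
Qed.

End Twisted.

Theorem lemma6 (R : realType) (n1 n2 : nat)
    (M1 : atlas R n1) (M2 : atlas R n2)
    (hM1 : is_smooth_manifold M1) (hM2 : is_smooth_manifold M2)
    (F1 : tangent_fun M1) (F2 : tangent_fun M2)
    (hF1 : is_finsler F1) (hF2 : is_finsler F2)
    (f : M1 * M2 -> R)
    (hf : smooth_fun (M := prod_atlas M1 M2) f) (hf0 : forall p, 0 < f p)
    (c1 : chart M1) (c2 : chart M2)
    (x y : 'rV[R]_n1) (u v : 'rV[R]_n2)
    (hx : cimg c1 x) (hu : cimg c2 u) (hy : y != 0) (hv : v != 0) :
  let fv := f (cinv c1 x, cinv c2 u) in
  let df := fun a : 'I_(n1 + n2) =>
    partial a (f \o cinv (a := prod_atlas M1 M2) (c1, c2)) (row_mx x u) in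
  let df1 := fun h : 'I_n1 => df (lshift n2 h) in
  let df2 := fun nu : 'I_n2 => df (rshift n1 nu) in
  let upf1 := fun k : 'I_n1 => \sum_h fund_inv (F1 c1) k h x y * df1 h in
  let upf2 := fun g : 'I_n2 => \sum_nu fund_inv (F2 c2) g nu u v * df2 nu in
  let C1 := cartan_up (F1 c1) in
  let C2 := cartan_up (F2 c2) in
  let g2 := fun al be : 'I_n2 => fund (F2 c2) al be u v in
  let vl := fun al : 'I_n2 => fib_low (F2 c2) al u v in
  let sqF2 := sqF (F2 c2) u v in
  let lat := fun i : 'I_n1 => lshift n2 i in
  let gre := fun al : 'I_n2 => rshift n1 al in
  let B := fun d a b c : 'I_(n1 + n2) =>
    berwald (twisted F1 F2 f (c1, c2)) d a b c (row_mx x u) (row_mx y v) in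
  (forall g al be la : 'I_n2,
     B (gre g) (gre al) (gre be) (gre la) =
       berwald (F2 c2) g al be la u v +
       fv^-1 *
        ((\sum_nu dy be (dy al (C2 g nu la)) u v * df2 nu) * sqF2
         + 2 * (\sum_nu dy be (C2 g nu al) u v * df2 nu) * vl la
         + 2 * (\sum_nu dy la (C2 g nu al) u v * df2 nu) * vl be
         + 2 * (\sum_nu C2 g nu al u v * df2 nu) * g2 la be
         + 2 * (\sum_nu dy be (C2 g nu la) u v * df2 nu) * vl al
         + 2 * (\sum_nu C2 g nu be u v * df2 nu) * g2 la al
         + 2 * (\sum_nu C2 g nu la u v * df2 nu) * g2 al be
         - 2 * cartan (F2 c2) al be la u v * upf2 g)) /\
  (forall k i j l : 'I_n1,
     B (lat k) (lat i) (lat j) (lat l) =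
       berwald (F1 c1) k i j l x y +
       fv * (\sum_h dy i (dy j (C1 k h l)) x y * df1 h) * sqF2) /\
  (forall (k i l : 'I_n1) (be : 'I_n2),
     B (lat k) (lat i) (gre be) (lat l) =
       2 * fv * (\sum_h dy l (C1 k h i) x y * df1 h) * vl be) /\
  (forall (k l : 'I_n1) (al be : 'I_n2),
     B (lat k) (gre al) (gre be) (lat l) =
       2 * fv * g2 al be * (\sum_h C1 k h l x y * df1 h)) /\
  (forall (k : 'I_n1) (al be la : 'I_n2),
     B (lat k) (gre al) (gre be) (gre la) =
       - 2 * fv * cartan (F2 c2) al be la u v * upf1 k) /\
  (forall (g : 'I_n2) (i : 'I_n1) (be la : 'I_n2),
     B (gre g) (lat i) (gre be) (gre la) = 0) /\
  (forall (g : 'I_n2) (i j : 'I_n1) (la : 'I_n2),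
     B (gre g) (lat i) (lat j) (gre la) = 0) /\
  (forall (g : 'I_n2) (i j k : 'I_n1),
     B (gre g) (lat i) (lat j) (lat k) = 0).
Proof.
move=> fv df df1 df2 upf1 upf2 C1 C2 g2 vl sqF2 lat gre B.
have lF1 : local_finsler (F1 c1) (cimg c1).
  split; [exact: mfd_open_img|exact: fins_smooth|exact: fins_homog|].
  exact: fins_posdef.
have lF2 : local_finsler (F2 c2) (cimg c2).
  split; [exact: mfd_open_img|exact: fins_smooth|exact: fins_homog|].
  exact: fins_posdef.
(* With this coordinate expression of [f], the metric [twisted] in the chart [(c1, c2)] is
   convertible with [twist]. *)
pose phi : 'rV[R]_(n1 + n2) -> R := f \o cinv (a := prod_atlas M1 M2) (c1, c2).
have phiE : phi (row_mx x u) = fv by rewrite /phi /= row_mxKl row_mxKr.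
have phi0 : phi (row_mx x u) != 0 by exact: lt0r_neq0 (hf0 _).
have dphi a : derivable (phi : _ -> R^o) (row_mx x u) (basis_vec a).
  apply: smooth_derivable (hf (c1, c2)) _.
  (* Smoothness of [f] is known on the image of the product chart, so a preimage of [row_mx x u] is
     exhibited. *)
  case: hx => p1 p1c <-; case: hu => p2 p2c <-.
  by exists (p1, p2).
rewrite -phiE; repeat split.
- by move=> g al be la; exact: (berwald_twist_rrr lF1 lF2 hx hu phi0 dphi hy hv).
- by move=> k i j l; exact: (berwald_twist_lll lF1 lF2 hx hu phi0 dphi hy hv).
- by move=> k i l be; exact: (berwald_twist_lrl lF1 lF2 hx hu phi0 dphi hy hv).
- by move=> k l al be; exact: (berwald_twist_rrl lF1 lF2 hx hu phi0 dphi hy hv).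
- by move=> k al be la; exact: (berwald_twist_l_rrr lF1 lF2 hx hu phi0 dphi hy hv).
- by move=> g i be la; exact: (berwald_twist_r_lrr lF1 lF2 hx hu phi0 dphi hy hv).
- by move=> g i j la; exact: (berwald_twist_r_llr lF1 lF2 hx hu phi0 dphi hy hv).
- by move=> g i j k; exact: (berwald_twist_r_lll lF1 lF2 hx hu phi0 dphi hy hv).
Qed.
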